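(* Let $n\ge 1$ and $1\le k\le n$ be integers, let $\mu\in\mathbb{R}$, and let $\mu_0:=\sqrt{\frac{k}{n(k+1)(C_n^k)^{1/k}}}$. Suppose that $f\in C(\mathbb{R})$ is a positive and monotone non-decreasing function. Suppose that either $k=1$ and $\mu\in(-\infty,\mu_0)$, or $2\le k\le n$ and $\mu\in[0,\mu_0)$. Then the equation $S_k^{1/k}(D^2u+\mu|Du|I)=f(u)$ in $\mathbb{R}^n$ admits a subsolution $u\in\Phi_\mu^k(\mathbb{R}^n)$ if and only if $$\int^{+\infty}\left(\int_{0}^{\tau}f^k(t)\,dt\right)^{-\frac{1}{k+1}}d\tau=+\infty.$$
   Context: $C_n^k$ denotes the binomial coefficient $\binom{n}{k}$. For $\lambda=(\lambda_1,\dots,\lambda_n)\in\mathbb{R}^n$, $S_k(\lambda)=\sum_{1\le i_1<\cdots<i_k\le n}\lambda_{i_1}\cdots\lambda_{i_k}$ is the $k$-th elementary symmetric function, and for a real symmetric $n\times n$ matrix $r$ with eigenvalues $\lambda(r)$, $S_k(r):=S_k(\lambda(r))$; $S_k^{1/k}$ is the $k$-th root of $S_k$. $Du$ and $D^2u$ are the gradient and Hessian of $u$, $|Du|$ is the Euclidean norm of the gradient, and $I$ is the $n\times n$ identity matrix. $\Gamma_k=\{\lambda\in\mathbb{R}^n: S_p(\lambda)>0 \text{ for all } p=1,\dots,k\}$. The class of admissible functions is $\Phi_\mu^k(\mathbb{R}^n)=\{u\in C^2(\mathbb{R}^n):\lambda(D^2u(x)+\mu|Du(x)|I)\in\Gamma_k\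 \text{for all } x\in\mathbb{R}^n\}$. A subsolution $u\in\Phi_\mu^k(\mathbb{R}^n)$ of the equation $S_k^{1/k}(D^2u+\mu|Du|I)=f(u)$ in $\mathbb{R}^n$ is a function $u\in\Phi_\mu^k(\mathbb{R}^n)$ with $S_k^{1/k}(D^2u+\mu|Du|I)\ge f(u)$ at every point of $\mathbb{R}^n$. In the integral $\int^{+\infty}$ the omitted lower limit is an arbitrary positive number. *)

(* Defs.v *)
From HB Require Import structures.
From mathcomp Require Import all_boot all_order all_algebra.
From mathcomp Require Import all_classical all_reals all_analysis.

Set Implicit Arguments.
Unset Strict Implicit.
Unset Printing Implicit Defensive.

Import Order.TTheory GRing.Theory Num.Theory.
Import numFieldNormedType.Exports.

Local Open Scope classical_set_scope.
Local Open Scope ring_scope.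

Definition elem_sym (R : realType) (n k : nat) (lam : 'rV[R]_n) : R :=
  \sum_(A : {set 'I_n} | #|A| == k) \prod_(i in A) lam 0 i.

(* The eigenvalues listed with algebraic multiplicity, in an unspecified order.
   Such a list exists for every real symmetric matrix; the default value 0 is
   taken only when the characteristic polynomial does not split over R. *)
Definition eigenvals (R : realType) (n : nat) (A : 'M[R]_n) : 'rV[R]_n :=
  xget 0 [set lam : 'rV[R]_n |
            char_poly A = \prod_(i < n) ('X - (lam 0 i)%:P)].

Definition Smx (R : realType) (n k : nat) (A : 'M[R]_n) : R :=
  elem_sym k (eigenvals A).

Definition Gamma (R : realType) (n k : nat) : set 'rV[R]_n :=
  [set lam | forall p : nat, (1 <= p <= k)%N -> 0 < elem_sym p lam].

Definition partial (R : realType) (n : nat) (i : 'I_n) (u : 'rV[R]_n -> R) :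
    'rV[R]_n -> R :=
  fun x => 'D_(delta_mx 0 i) u x.

Definition C2 (R : realType) (n : nat) (u : 'rV[R]_n -> R) : Prop :=
  [/\ continuous u,
      forall i : 'I_n,
        (forall x, derivable u x (delta_mx 0 i)) /\ continuous (partial i u)
    & forall i j : 'I_n,
        (forall x, derivable (partial i u) x (delta_mx 0 j)) /\
        continuous (partial j (partial i u))].

Definition grad (R : realType) (n : nat) (u : 'rV[R]_n -> R) (x : 'rV[R]_n) :
    'rV[R]_n :=
  \row_i partial i u x.

Definition hessian (R : realType) (n : nat) (u : 'rV[R]_n -> R)
    (x : 'rV[R]_n) : 'M[R]_n :=
  \matrix_(i, j) partial j (partial i u) x.

(* The norm `|v| provided by the library on 'rV[R]_n is the sup norm. *)
Definition enorm (R : realType) (n : nat) (v : 'rV[R]_n) : R :=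
  Num.sqrt (\sum_i v 0 i ^+ 2).

Definition aug_hessian (R : realType) (n : nat) (mu : R)
    (u : 'rV[R]_n -> R) (x : 'rV[R]_n) : 'M[R]_n :=
  hessian u x + (mu * enorm (grad u x))%:M.

Definition Phi (R : realType) (n k : nat) (mu : R) : set ('rV[R]_n -> R) :=
  [set u | C2 u /\ forall x, Gamma k (eigenvals (aug_hessian mu u x))].

Definition subsolution (R : realType) (n k : nat) (mu : R) (f : R -> R)
    (u : 'rV[R]_n -> R) : Prop :=
  Phi k mu u /\
  forall x, f (u x) <= Smx k (aug_hessian mu u x) `^ (k%:R^-1).

Definition mu0 (R : realType) (n k : nat) : R :=
  Num.sqrt (k%:R / (n%:R * k.+1%:R * ('C(n, k)%:R `^ (k%:R^-1)))).

(* Main.v *)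
Require Import Defs.
From HB Require Import structures.
From mathcomp Require Import all_boot all_order all_algebra.
From mathcomp Require Import all_classical all_reals all_analysis.
From mathcomp Require Import measurable_realfun ring lra zify.

Set Implicit Arguments.
Unset Strict Implicit.
Unset Printing Implicit Defensive.

Import Order.TTheory GRing.Theory Num.Theory.
Import numFieldNormedType.Exports.

Local Open Scope classical_set_scope.
Local Open Scope ring_scope.

(* Both directions use radial functions u(x) = psi(|x|^2 / 2) with psi' = G(psi), i.e.
   psi is the inverse of the time map T = \int 1 / G, so that no existence theory for
   differential equations is needed. Such a u satisfies D^2 u = psi' I + psi'' x^T x,
   and G^(k+1) is essentially the primitive of f^k.
   If the integral diverges, then T is unbounded, psi is defined on [0, +oo[ and u is
   an entire subsolution. If it converges, then taking G small gives a strict radial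
   supersolution on a ball, which lies below the given subsolution at the centre and
   blows up at the boundary. Where the difference is maximal the Hessians are ordered,
   and monotonicity of S_k on the closure of Gamma_k gives a contradiction. *)

(** * Elementary symmetric functions of sequences *)

Section ElementarySymmetricSeq.
Variable R : rcfType.
Implicit Types (s r : seq R) (x y t : R) (k m p : nat).

(** From [psi' = G(psi)] follows [psi'' = G'(psi) G(psi)]. Up to powers of [1 + mu |x|], the term of
    S_k containing [psi''] is therefore a multiple of [|x|^2 G' G^k] at [psi], which explains why
    [G^(k+1)] should be a primitive of a multiple of [f^k]. The factor [|x|^2] is the obstacle. Near
    the origin it makes this term useless, so the subsolution needs the other term, a multiple of
    [(psi')^k], to dominate [f^k] there; this dictates the additive constant in [G^(k+1)]. For the
    supersolution that other term must be a small multiple of [f^k]. This needs [G <= A f], which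
    holds because convergence of the integral forces [f] to grow at least linearly. Replacing [G] by
    [eps G] stretches the life span of [psi] to order [1 / eps], so [|x|] is at most of order
    [eps^(-1/2)], while [psi'] gains a factor [eps] and [psi''] a factor [eps^2]. Hence
    [mu |x| psi'] and [|x|^2 psi''] become small with [eps]. In the analytic lemmas [k] is the order
    of the operator minus one, so the exponents [k] and [1/(k+1)] appear as [k.+1] and
    [k.+2%:R^-1]. *)

Definition esp s : {poly R} := \prod_(x <- s) (1 + x *: 'X).
(** Lists instead of rows, so that an entry can be deleted with [rem] and induction runs over the
    entries; as coefficients of [esp] the functions vanish beyond the length and ignore the
    order. *)
Definition es k s : R := (esp s)`_k.

Lemma esp_cons x s : esp (x :: s) = (1 + x *: 'X) * esp s.
Proof. by rewrite /esp big_cons. Qed.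

Lemma esS k x s : es k.+1 (x :: s) = es k.+1 s + x * es k s.
Proof. by rewrite /es esp_cons mulrDl mul1r -scalerAl coefD coefZ coefXM. Qed.

Lemma es0 s : es 0 s = 1.
Proof.
elim: s => [|x s IH]; first by rewrite /es /esp big_nil coef1.
by rewrite /es esp_cons mulrDl mul1r -scalerAl coefD coefZ coefXM /= mulr0 addr0.
Qed.

Lemma es_perm k s r : perm_eq s r -> es k s = es k r.
Proof. by move=> sr; rewrite /es /esp (perm_big _ sr). Qed.

Lemma es_oversize k s : (size s < k)%N -> es k s = 0.
Proof.
elim: s k => [|x s IH] [|k] // sk; first by rewrite /es /esp big_nil coef1.
by rewrite esS !IH ?mulr0 ?addr0// ltnW.
Qed.

Lemma es_gt0 k s : (k <= size s)%N -> {in s, forall x, 0 < x} -> 0 < es k s.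
Proof.
elim: s k => [|x s IH] [|k] //= sk s0; rewrite ?es0 ?ltr01//.
have s0' : {in s, forall y, 0 < y} by move=> y ys; rewrite s0// inE ys orbT.
rewrite esS ltr_wpDl//; last by rewrite mulr_gt0// ?IH// s0// mem_head.
case: (ltnP (size s) k.+1) => [|ks]; first by move/es_oversize->.
by rewrite ltW// IH.
Qed.

Lemma deriv_esp s : (esp s)^`() = \sum_(x <- s) x *: esp (rem x s).
Proof.
elim: s => [|y s IH]; first by rewrite /esp !big_nil derivC.
rewrite esp_cons derivM IH derivD derivC add0r derivZ derivX big_cons /= eqxx.
rewrite -scalerAl mul1r; congr (_ + _).
rewrite mulr_sumr; apply: eq_big_seq => x xs /=.
rewrite -scalerAr; congr (_ *: _).
case: eqP => [->|_]; last by rewrite esp_cons.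
by rewrite -esp_cons /esp (perm_big _ (perm_to_rem xs)).
Qed.

(** Multiply [esp s = (1 + x *: 'X) * esp (rem x s)] by [x] and sum over [s]. The first terms add up
    to the derivative of [esp s], the second ones to ['X] times the generating polynomial of the
    left-hand sums. The identity is the coefficient of degree [m.+1]. *)
Lemma sum_sqr_es m s :
  \sum_(x <- s) x ^+ 2 * es m (rem x s) =
  es 1 s * es m.+1 s - m.+2%:R * es m.+2 s.
Proof.
have e1 : es 1 s = \sum_(x <- s) x.
  elim: s => [|y s IH]; first by rewrite big_nil /es /esp big_nil coef1.
  by rewrite esS es0 mulr1 IH big_cons addrC.
have key : es 1 s *: esp s =
    (esp s)^`() + 'X * \sum_(x <- s) x ^+ 2 *: esp (rem x s).
  rewrite deriv_esp mulr_sumr -big_split /= e1 scaler_suml.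
  apply: eq_big_seq => x xs.
  have -> : esp s = (1 + x *: 'X) * esp (rem x s).
    by rewrite -esp_cons /esp (perm_big _ (perm_to_rem xs)).
  by rewrite mulrDl mul1r scalerDr -scalerAl scalerA scalerAr.
have := congr1 (fun q : {poly R} => q`_m.+1) key.
rewrite coefZ coefD coef_deriv coefXM /= -/(es _ _) -/(es _ _).
rewrite coef_sum -/(es _ _) => ->; rewrite mulr_natl [X in X - _]addrC addrK.
by apply: eq_bigr => x _; rewrite coefZ.
Qed.

Definition shift_seq t s := [seq x + t | x <- s].

Lemma size_prod_XaddC s : size (\prod_(x <- s) ('X + x%:P)) = (size s).+1.
Proof.
rewrite -(size_map -%R s) -(size_prod_XsubC _ id) big_map.
by under [in RHS]eq_bigr => y _ do rewrite /= polyCN opprK.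
Qed.

Lemma coef_prod_XaddC s i : (i <= size s)%N ->
  (\prod_(x <- s) ('X + x%:P))`_i = es (size s - i) s.
Proof.
elim: s i => [|x s IH] i; first by rewrite leqn0 => /eqP ->; rewrite big_nil es0 coef1.
rewrite big_cons mulrDl coefD coefXM coefCM /= => iS.
case: i iS => [_|i iS] /=.
  by rewrite add0r IH// !subn0 esS (es_oversize (ltnSn _)) add0r.
rewrite IH// subSS; move: iS; rewrite [(i < _)%N]ltnS leq_eqVlt => /predU1P[->|iS].
  rewrite subnn !es0 nth_default ?mulr0 ?addr0//.
  by rewrite size_prod_XaddC.
rewrite IH//; have -> : (size s - i = (size s - i.+1).+1)%N by lia.
by rewrite esS.
Qed.

Lemma coef_comp_XaddC (q : {poly R}) t i : (q \Po ('X + t%:P))`_i = q^`N(i).[t].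
Proof.
elim/poly_ind: q i => [|q c IH] i; first by rewrite comp_poly0 coef0 linear0 horner0.
rewrite comp_poly_MXaddC coefD coefC mulrDr coefD coefMX coefMC.
case: i => [|i] /=.
  by rewrite add0r IH !nderivn0 hornerMXaddC.
by rewrite !IH nderivnMXaddC hornerD hornerMX addr0.
Qed.

(** The [k]-th elementary symmetric function of the shifted list as a polynomial in the shift, a
    normalised derivative by Taylor's formula. As a polynomial it admits an intermediate value
    argument, and its coefficients are the [es p s], [p <= k], up to binomial factors. *)
Definition es_shift_poly k s : {poly R} :=
  (\prod_(x <- s) ('X + x%:P))^`N(size s - k).

Lemma horner_es_shift k s t : (k <= size s)%N ->
  (es_shift_poly k s).[t] = es k (shift_seq t s).
Proof.
move=> ks; rewrite /es_shift_poly -coef_comp_XaddC.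
have -> : (\prod_(x <- s) ('X + x%:P)) \Po ('X + t%:P) =
          \prod_(x <- shift_seq t s) ('X + x%:P).
  rewrite rmorph_prod /= big_map; apply: eq_bigr => x _.
  by rewrite rmorphD /= comp_polyX comp_polyC -addrA -polyCD [t + x]addrC.
by rewrite coef_prod_XaddC size_map ?leq_subr// subKn.
Qed.

(** The inequalities of [Gamma] in nonstrict form: the induction for [es_rem_ge0] applies them to a
    list on which the top function vanishes. *)
Definition cone k s := forall p, (p <= k)%N -> 0 <= es p s.

Lemma cone_le k p s : (p <= k)%N -> cone k s -> cone p s.
Proof. by move=> pk ck q qp; apply: ck; apply: leq_trans pk. Qed.

(** On the cone all coefficients of [es_shift_poly k s] are nonnegative, and the one of degree [k]
    is a binomial coefficient, hence positive. *)
Lemma es_shift_gt0 k s t : 0 < t -> (k <= size s)%N -> cone k s ->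
  0 < es k (shift_seq t s).
Proof.
move=> t0 ks ck; rewrite -horner_es_shift// /es_shift_poly.
rewrite (@horner_coef_wide _ k.+1); last first.
  by rewrite (leq_trans (size_poly _ _))// size_prod_XaddC; lia.
rewrite big_ord_recr /= ltr_wpDl//.
  apply: sumr_ge0 => i _; rewrite coef_nderivn.
  apply: mulr_ge0; last by rewrite exprn_ge0// ltW.
  apply: mulrn_wge0.
  rewrite coef_prod_XaddC; last by have := ltn_ord i; lia.
  by apply: ck; have := ltn_ord i; lia.
rewrite coef_nderivn mulr_gt0 ?exprn_gt0// subnK//.
by rewrite coef_prod_XaddC// subnn es0 ltr0n bin_gt0 leq_subr.
Qed.

(* If [es m] is negative on [s], shift all entries until it vanishes: there
   [es m.+1 s] is positive by [esS], but [sum_sqr_es] makes it nonpositive. *)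
Lemma es_rem_ge0 k x s : cone k.+1 (x :: s) -> 0 <= es k s.
Proof.
elim/ltn_ind: k x s => -[_ x s _|m IH x s cxs]; first by rewrite es0 ler01.
have [ms|/es_oversize -> //] := leqP m.+1 (size s).
rewrite leNgt; apply/negP => em0.
have cs : cone m s.
  move=> p pm; apply: (IH p _ x); first by rewrite ltnS.
  by apply: cone_le cxs; rewrite ltnS ltnW.
(* After a shift by [b] all entries are positive; this supplies the opposite sign for the
   intermediate value theorem. *)
pose b := \sum_(y <- s) `|y| + 1.
have b0 : 0 <= b by rewrite addr_ge0// sumr_ge0.
have eb : 0 < es m.+1 (shift_seq b s).
  apply: es_gt0; first by rewrite size_map.
  move=> _ /mapP[y ys ->]; rewrite /b (perm_big _ (perm_to_rem ys)) big_cons.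
  rewrite addrA addrA ltr_wpDl// addr_ge0// ?sumr_ge0//.
  by rewrite -lerBlDl sub0r -normrN ler_norm.
have /(poly_ivt b0)[t] : (es_shift_poly m.+1 s).[0] <= 0 <= (es_shift_poly m.+1 s).[b].
  rewrite !horner_es_shift// (ltW eb) andbT /shift_seq.
  by under eq_map => y do rewrite addr0; rewrite map_id ltW.
move=> /andP[t0 tb]; rewrite rootE horner_es_shift// => /eqP et0.
have {}t0 : 0 < t.
  rewrite lt_def t0 andbT; apply: contraL em0 => /eqP t0'; rewrite -leNgt.
  move: et0; rewrite t0' /shift_seq; under eq_map => y do rewrite addr0.
  by rewrite map_id => ->.
have ek : 0 < es m.+2 (shift_seq t s).
  have := @es_shift_gt0 m.+2 (x :: s) t t0 ms cxs.
  by rewrite /= esS et0 mulr0 addr0.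
have := sum_sqr_es m (shift_seq t s); rewrite et0 mulr0 sub0r => /eqP.
apply/negP; rewrite gt_eqF// (@lt_le_trans _ _ 0)//.
  by rewrite oppr_lt0 mulr_gt0// ltr0n.
(* The shifted list lies in the cone of order [m.+1], with [es m.+1] equal to zero, so by induction
   [es m] is nonnegative once an entry is removed. *)
rewrite big_seq sumr_ge0// => y ys; rewrite mulr_ge0 ?sqr_ge0//.
apply: (IH m _ y) => // p; rewrite leq_eqVlt => /predU1P[->|pm].
  by rewrite -(es_perm _ (perm_to_rem ys)) et0.
rewrite -(es_perm _ (perm_to_rem ys)) ltW// es_shift_gt0//; first by lia.
exact: cone_le cs.
Qed.

(** The entries are raised one at a time, [u] being the part already treated. Each [es p] is affine
    in a single entry, with slope [es p.-1] of the others, nonnegative by [es_rem_ge0]; the lower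
    functions grow as well, so the list stays in the cone. *)
Lemma es_le k s r : cone k s -> all2 (fun x y => x <= y) s r -> es k s <= es k r.
Proof.
suff H u : cone k (u ++ s) -> all2 (fun x y => x <= y) s r ->
    es k (u ++ s) <= es k (u ++ r) by exact: (H [::]).
elim: s r u => [|x s IH] [|y r] u //= cu /andP[xy sr].
have px : perm_eq (u ++ x :: s) (x :: (u ++ s)) by rewrite perm_catC /= perm_cons perm_catC.
have py : perm_eq (rcons u y ++ s) (y :: (u ++ s)).
  by rewrite -cats1 -catA perm_catC /= perm_cons perm_catC.
have le p : (p <= k)%N -> es p (u ++ x :: s) <= es p (rcons u y ++ s).
  case: p => [|p] pk; first by rewrite !es0.
  rewrite (es_perm _ px) (es_perm _ py) !esS lerD2l ler_wpM2r//.
  apply: (@es_rem_ge0 _ x) => q qp; rewrite -(es_perm _ px); apply: cu.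
  exact: leq_trans pk.
rewrite (le_trans (le k _))// -[in leRHS]cat_rcons IH// => p pk.
exact: le_trans (cu p pk) (le p pk).
Qed.

End ElementarySymmetricSeq.

(** * Symmetric matrices and rank-one perturbations of scalar matrices *)

Section OrthogonalMatrices.
Variable R : rcfType.
Implicit Types n : nat.

Definition sqnorm n (v : 'rV[R]_n) : R := \sum_i v 0 i ^+ 2.

Lemma mulmx_trE n (v w : 'rV[R]_n) : v *m w^T = (\sum_i v 0 i * w 0 i)%:M.
Proof.
rewrite [LHS]mx11_scalar mxE; congr (_%:M).
by apply: eq_bigr => i _; rewrite mxE.
Qed.

Lemma mulmx_tr_sqnorm n (v : 'rV[R]_n) : v *m v^T = (sqnorm v)%:M.
Proof. by rewrite mulmx_trE. Qed.

Lemma sqnorm_ge0 n (v : 'rV[R]_n) : 0 <= sqnorm v.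
Proof. by apply: sumr_ge0 => i _; rewrite sqr_ge0. Qed.

Lemma sqnorm_eq0 n (v : 'rV[R]_n) : sqnorm v = 0 -> v = 0.
Proof.
move=> /eqP; rewrite psumr_eq0 => [/allP v0|i _]; last exact: sqr_ge0.
apply/rowP => i; rewrite mxE.
by have := v0 i (mem_index_enum _); rewrite sqrf_eq0 => /eqP.
Qed.

Lemma sqnormZ n (a : R) (v : 'rV[R]_n) : sqnorm (a *: v) = a ^+ 2 * sqnorm v.
Proof. by rewrite mulr_sumr; apply: eq_bigr => i _; rewrite mxE exprMn. Qed.

Lemma orthogonal_sqnorm n (P : 'M[R]_n) (v : 'rV[R]_n) :
  P *m P^T = 1%:M -> sqnorm (v *m P) = sqnorm v.
Proof.
move=> PP; have := mulmx_tr_sqnorm (v *m P).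
rewrite trmx_mul mulmxA -(mulmxA v) PP mulmx1 mulmx_tr_sqnorm => /matrixP/(_ 0 0).
by rewrite !mxE.
Qed.

(** Reflection in the hyperplane orthogonal to [w = v - a *: e]. It maps [v] to [a *: e] because [v]
    and [a *: e] have the same norm, which makes the product of [v] and [w] half of the squared norm
    of [w]. *)
Lemma householder n (v : 'rV[R]_n.+1) :
  exists2 P : 'M[R]_n.+1, P *m P^T = 1%:M &
    v *m P = Num.sqrt (sqnorm v) *: delta_mx 0 0.
Proof.
set a : R := Num.sqrt _; set e : 'rV[R]_n.+1 := delta_mx 0 0.
have [->|wn0] := eqVneq v (a *: e).
  by exists 1%:M; rewrite ?trmx1 !mulmx1.
pose w := v - a *: e; pose c := sqnorm w.
have c0 : c != 0 by apply: contraNneq wn0 => /sqnorm_eq0/eqP; rewrite subr_eq0.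
have ww : w *m w^T = c%:M by exact: mulmx_tr_sqnorm.
have aa : a ^+ 2 = sqnorm v by rewrite sqr_sqrtr// sqnorm_ge0.
have vw : v *m w^T = (c / 2)%:M.
  rewrite mulmx_trE; congr (_%:M).
  have ve (u : 'rV[R]_n.+1) : \sum_i u 0 i * (a *: e) 0 i = a * u 0 0.
    rewrite (bigD1 0)//= !mxE !eqxx mulr1 big1 ?addr0 1?mulrC// => i i0.
    by rewrite !mxE (negbTE i0) andbF !mulr0.
  have -> : \sum_i v 0 i * w 0 i = a ^+ 2 - a * v 0 0.
    rewrite aa -ve -sumrB; apply: eq_bigr => i _.
    by rewrite /w !mxE mulrBr expr2.
  have -> : c = sqnorm v - 2 * \sum_i v 0 i * (a *: e) 0 i + \sum_i (a *: e) 0 i * (a *: e) 0 i.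
    rewrite mulr_sumr -sumrB -big_split /=; apply: eq_bigr => i _.
    by rewrite /w !mxE; ring.
  by rewrite !ve -aa !mxE !eqxx mulr1; field.
pose U := w^T *m w.
have UT : U^T = U by rewrite /U trmx_mul trmxK.
have UU : U *m U = c *: U.
  by rewrite /U !mulmxA -(mulmxA w^T w w^T) ww mul_mx_scalar scalemxAl.
exists (1%:M - (2 / c) *: U).
  have -> : (1%:M - (2 / c) *: U)^T = 1%:M - (2 / c) *: U.
    by rewrite [LHS]raddfB /= trmx1 linearZ /= UT.
  rewrite mulmxBl !mulmxBr !mul1mx !mulmx1 -scalemxAl -scalemxAr UU !scalerA.
  by apply/matrixP => i j; rewrite !mxE; field.
rewrite mulmxBr mulmx1 -scalemxAr mulmxA vw mul_scalar_mx scalerA.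
have -> : 2 / c * (c / 2) = 1 by field.
by rewrite scale1r /w opprB addrC subrK.
Qed.

Lemma char_poly_conj n (P A : 'M[R]_n) : P *m P^T = 1%:M ->
  char_poly (P^T *m A *m P) = char_poly A.
Proof.
move=> PP; have PP' : P^T *m P = 1%:M by rewrite (mulmx1C PP).
rewrite /char_poly.
have -> : char_poly_mx (P^T *m A *m P) =
   map_mx polyC P^T *m char_poly_mx A *m map_mx polyC P.
  rewrite /char_poly_mx mulmxBr mulmxBl !map_mxM; congr (_ - _).
  by rewrite mul_mx_scalar -scalemxAl -map_mxM PP' map_mx1 scalemx1.
rewrite !det_mulmx mulrAC -det_mulmx -map_mxM PP' map_mx1.
by rewrite det1 mul1r.
Qed.

(** The splitting hypothesis supplies an eigenvector at each stage. A reflection moves it to the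
    first basis vector; symmetry then makes the conjugated matrix block diagonal, and the remaining
    block has the remaining roots. *)
Lemma symmetric_diag n (A : 'M[R]_n) (s : seq R) : A^T = A ->
  char_poly A = \prod_(x <- s) ('X - x%:P) ->
  exists (Q : 'M[R]_n) (d : 'rV[R]_n),
    Q *m Q^T = 1%:M /\ A = Q *m diag_mx d *m Q^T.
Proof.
elim: n A s => [|n IH] A s symA chA.
  by exists 1%:M, 0; split; apply/matrixP => -[].
case: s chA => [|a s] chA.
  by have := size_char_poly A; rewrite chA big_nil size_poly1.
have /eigenvalueP[v vA v0] : eigenvalue A a.
  by rewrite eigenvalue_root_char chA big_cons rootM root_XsubC eqxx.
have [P PP vP] := householder v.
have PP' : P^T *m P = 1%:M by rewrite (mulmx1C PP).
set b := Num.sqrt _ in vP.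
have b0 : b != 0.
  rewrite sqrtr_eq0 -ltNge lt_def sqnorm_ge0 andbT.
  by apply: contraNneq v0 => /sqnorm_eq0 ->.
pose B : 'M[R]_(1 + n) := P^T *m A *m P.
have symB : B^T = B by rewrite /B !trmx_mul trmxK symA mulmxA.
have rowB : (delta_mx 0 0 : 'rV[R]_(1 + n)) *m B = a *: delta_mx 0 0.
  have -> : delta_mx 0 0 = b^-1 *: (v *m P) :> 'rV[R]_(1 + n).
    by rewrite vP scalerA mulVf// scale1r.
  rewrite /B -scalemxAl !mulmxA -(mulmxA v) PP mulmx1 vA -scalemxAl scalerA.
  by rewrite scalerA mulrC.
have AB : A = P *m B *m P^T.
  by rewrite /B !mulmxA PP mul1mx -mulmxA PP mulmx1.
have chBA : char_poly B = char_poly A by exact: char_poly_conj.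
clearbody B.
have ursub : ursubmx B = 0.
  apply/rowP => j; rewrite !mxE.
  have := congr1 (fun M : 'rV[R]_(1 + n) => M 0 (rshift 1 j)) rowB.
  by rewrite -rowE !mxE /= mulr0 => <-; congr (fun_of_matrix B _ _); apply/val_inj.
have ulsub : ulsubmx B = a%:M.
  rewrite [LHS]mx11_scalar !mxE; congr (_%:M).
  have := congr1 (fun M : 'rV[R]_(1 + n) => M 0 (lshift n 0)) rowB.
  rewrite -rowE !mxE /= mulr1 => <-; congr (fun_of_matrix B _ _); exact/val_inj.
have dlsub : dlsubmx B = 0 by rewrite -symB -trmx_ursub ursub trmx0.
have Bblock : B = block_mx a%:M 0 0 (drsubmx B).
  by rewrite -[LHS]submxK ursub ulsub dlsub.
have chB : char_poly (drsubmx B) = \prod_(x <- s) ('X - x%:P).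
  have : char_poly B = ('X - a%:P) * char_poly (drsubmx B).
    rewrite {1}Bblock /char_poly /char_poly_mx (scalar_mx_block 1 n) map_block_mx.
    rewrite !map_mx0 opp_block_mx add_block_mx !oppr0 !addr0.
    by rewrite det_ublock map_scalar_mx /= -raddfB det_scalar1.
  by rewrite chBA chA big_cons => /mulfI -> //; rewrite polyXsubC_eq0.
have symB' : (drsubmx B)^T = drsubmx B by rewrite trmx_drsub symB.
have [Q [d [QQ Bd]]] := IH _ _ symB' chB.
pose Q1 : 'M[R]_(1 + n) := block_mx 1%:M 0 0 Q.
have QQ1 : Q1 *m Q1^T = 1%:M.
  rewrite /Q1 tr_block_mx trmx1 !trmx0 mulmx_block !mulmx0 !mul0mx mulmx1 !addr0 !add0r QQ.
  by rewrite -scalar_mx_block.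
pose D : 'M[R]_(1 + n) := diag_mx (row_mx a%:M d).
have BQ : B = Q1 *m (D *m Q1^T).
  rewrite [LHS]Bblock /Q1 /D diag_mx_row tr_block_mx trmx1 !trmx0 !mulmx_block.
  rewrite !mulmx0 !mul0mx !mul1mx !mulmx1 !addr0 !add0r ?mulmx0 ?mul0mx mulmxA -Bd.
  by congr block_mx; apply/matrixP => i j; rewrite !ord1 !mxE.
exists (P *m (Q1 : 'M[R]_n.+1)), (row_mx a%:M d : 'rV[R]_(1 + n)); split.
  by rewrite trmx_mul mulmxA -(mulmxA P) QQ1 mulmx1.
by rewrite AB BQ trmx_mul !mulmxA.
Qed.

Lemma char_poly_diag n (d : 'rV[R]_n) :
  char_poly (diag_mx d) = \prod_i ('X - (d 0 i)%:P).
Proof.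
rewrite char_poly_trig; last exact: diag_mx_is_trig.
by apply: eq_bigr => i _; rewrite mxE eqxx.
Qed.

(** The spectrum of a scalar matrix plus a rank-one matrix: [al] with multiplicity [n], and
    [al + be] in the direction of the vector. *)
Definition rank1_row n (al be : R) : 'rV[R]_n.+1 :=
  \row_i (al + (i == 0)%:R * be).

Lemma conj_rank1 n (al be : R) (x : 'rV[R]_n) (P : 'M[R]_n) :
  P^T *m (al%:M + be *: (x^T *m x)) *m P =
  al *: (P^T *m P) + be *: ((x *m P)^T *m (x *m P)).
Proof.
rewrite mulmxDr mulmxDl mul_mx_scalar -scalemxAl -scalemxAr -scalemxAl.
by rewrite trmx_mul !mulmxA.
Qed.

Lemma char_poly_rank1 n (al be : R) (x : 'rV[R]_n.+1) :
  char_poly (al%:M + be *: (x^T *m x)) =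
  \prod_i ('X - (rank1_row n al (be * sqnorm x) 0 i)%:P).
Proof.
have [P PP xP] := householder x.
have PP' : P^T *m P = 1%:M by rewrite (mulmx1C PP).
rewrite -(char_poly_conj _ PP) -char_poly_diag; congr char_poly.
rewrite conj_rank1 PP' scalemx1 xP.
apply/matrixP => i j; rewrite !mxE big_ord1 !mxE !eqxx /=.
rewrite mulrACA -expr2 sqr_sqrtr ?sqnorm_ge0//.
have [->|ij] := eqVneq i j; rewrite ?mulr1n ?mulr0n ?add0r.
  by have [_|_] := eqVneq j 0; rewrite ?mulr1 ?mulr0 ?mul1r ?mul0r ?mulr0.
have [i0|_] := eqVneq i 0; last by rewrite !mul0r !mulr0.
have [j0|_] := eqVneq j 0; last by rewrite !mulr0.
by rewrite i0 j0 eqxx in ij.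
Qed.

Lemma es_nseq k m (al : R) : es k (nseq m al) = 'C(m, k)%:R * al ^+ k.
Proof.
elim: m k => [|m IH] [|k]; rewrite ?es0 ?bin0 ?mulr1//.
  by rewrite es_oversize// bin0n mul0r.
by rewrite esS !IH binS natrD exprS; ring.
Qed.

Definition row_seq n (d : 'rV[R]_n) : seq R := [seq d 0 i | i <- enum 'I_n].

Lemma row_seq_rank1 n (al be : R) :
  row_seq (rank1_row n al be) = (al + be) :: nseq n al.
Proof.
rewrite /row_seq enum_ordSl /= mxE mul1r; congr (_ :: _).
rewrite -map_comp -[in RHS](size_enum_ord n).
elim: (enum _) => //= i s ->; congr (_ :: _).
by rewrite !mxE mul0r addr0.
Qed.

Lemma es_rank1_row n k (al be : R) :
  es k.+1 (row_seq (rank1_row n al be)) =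
  'C(n.+1, k.+1)%:R * al ^+ k.+1 + 'C(n, k)%:R * be * al ^+ k.
Proof.
by rewrite row_seq_rank1 esS !es_nseq binS natrD exprS; ring.
Qed.

(* At most one entry of [d] exceeds [al]: given two, test the hypothesis with the
   combination of the two coordinate vectors that is orthogonal to [z]. *)
Lemma es_diag_le_rank1 n k (d z : 'rV[R]_n.+1) (al be : R) : 0 <= be ->
  (forall y : 'rV[R]_n.+1, \sum_i y 0 i ^+ 2 * d 0 i <=
     al * sqnorm y + be * (\sum_i y 0 i * z 0 i) ^+ 2) ->
  cone k (row_seq d) ->
  es k (row_seq d) <= es k (row_seq (rank1_row n al (be * sqnorm z))).
Proof.
move=> be0 H cd.
have sum_delta (g : 'I_n.+1 -> R) i :
    \sum_j (delta_mx 0 i : 'rV[R]_n.+1) 0 j * g j = g i.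
  rewrite (bigD1 i)//= mxE !eqxx mul1r big1 ?addr0// => j ji.
  by rewrite mxE (negbTE ji) mul0r.
have sum_delta2 (g : 'I_n.+1 -> R) i :
    \sum_j (delta_mx 0 i : 'rV[R]_n.+1) 0 j ^+ 2 * g j = g i.
  rewrite -[RHS](sum_delta g i); apply: eq_bigr => j _; rewrite mxE eqxx /=.
  by case: (j == i); rewrite ?expr1n ?expr0n.
have sq_delta i : sqnorm (delta_mx 0 i : 'rV[R]_n.+1) = 1.
  rewrite -(sum_delta2 (fun=> 1) i); apply: eq_bigr => j _; exact/esym/mulr1.
have dz i : d 0 i <= al + be * z 0 i ^+ 2.
  by have := H (delta_mx 0 i); rewrite sum_delta2 sq_delta sum_delta mulr1.
have uniq_big i j : i != j -> al < d 0 i -> al < d 0 j -> False.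
  move=> ij di dj.
  pose y : 'rV[R]_n.+1 := \row_l (z 0 j * (l == i)%:R - z 0 i * (l == j)%:R).
  have yS (g : R -> R) (h : 'I_n.+1 -> R) : g 0 = 0 ->
      \sum_l g (y 0 l) * h l = g (z 0 j) * h i + g (- z 0 i) * h j.
    move=> g0; rewrite (bigD1 i)//= (bigD1 j) ?big1 ?addr0 1?eq_sym//=.
      by rewrite !mxE !eqxx [j == i]eq_sym (negbTE ij) !mulr1 !mulr0 subr0 sub0r addr0.
    by move=> l /andP[li lj]; rewrite !mxE (negbTE li) (negbTE lj) !mulr0 subr0 g0 mul0r.
  have := H y.
  rewrite (yS (fun t => t ^+ 2)) ?expr0n// (yS id)//.
  have -> : sqnorm y = z 0 j ^+ 2 + z 0 i ^+ 2.
    transitivity (\sum_l y 0 l ^+ 2 * 1); first by apply: eq_bigr => l _; rewrite mulr1.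
    by rewrite (yS (fun t => t ^+ 2) (fun=> 1)) ?expr0n// !mulr1 sqrrN.
  have -> : (z 0 j * z 0 i + - z 0 i * z 0 j) = 0 by ring.
  rewrite expr0n mulr0 addr0 sqrrN => Hy.
  have zi : z 0 i = 0.
    apply/eqP; rewrite -sqrf_eq0 eq_le sqr_ge0 andbT.
    by have := sqr_ge0 (z 0 i); have := sqr_ge0 (z 0 j); nra.
  by have := dz i; rewrite zi expr0n mulr0 addr0 leNgt di.
have [i0 Hi0] : exists i0, forall j, j != i0 -> d 0 j <= al.
  have [i di|no] := pickP (fun i => al < d 0 i).
    exists i => j ji; rewrite leNgt; apply/negP => dj; exact: (uniq_big j i).
  by exists 0 => j _; rewrite leNgt no.
have pe : perm_eq (row_seq d) (d 0 i0 :: [seq d 0 i | i <- rem i0 (enum 'I_n.+1)]).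
  by rewrite -[_ :: _]/(map (d 0) (i0 :: _)) perm_map// perm_to_rem// mem_enum.
have -> : row_seq (rank1_row n al (be * sqnorm z)) =
    (al + be * sqnorm z) :: nseq (size (rem i0 (enum 'I_n.+1))) al.
  by rewrite size_rem ?mem_enum// size_enum_ord row_seq_rank1.
rewrite (es_perm _ pe); apply: es_le.
  by move=> p pk; rewrite -(es_perm _ pe); apply: cd.
rewrite /= (le_trans (dz i0)) ?lerD2l ?ler_wpM2l//=.
  have : {in rem i0 (enum 'I_n.+1), forall j, d 0 j <= al}.
    by move=> j; rewrite mem_rem_uniq ?enum_uniq// inE => /andP[/Hi0].
  elim: (rem _ _) => //= j s IH Hs; rewrite Hs ?mem_head//= IH// => l ls.
  by rewrite Hs// inE ls orbT.
by rewrite /sqnorm (bigD1 i0)//= lerDl sumr_ge0// => i _; rewrite sqr_ge0.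
Qed.

End OrthogonalMatrices.

(** * The operator S_k on matrices *)

Section HessianOperator.
Variable R : realType.

Lemma elem_symE n k (lam : 'rV[R]_n) : elem_sym k lam = es k (row_seq lam).
Proof.
rewrite /es /esp /row_seq big_map big_enum /=.
under eq_bigr => i _ do rewrite addrC.
rewrite bigA_distr /= coef_sum /elem_sym [LHS]big_mkcond; apply: eq_bigr => A _.
rewrite big_if /= big1_eq mulr1 scaler_prod prodr_const coefZ coefXn eq_sym.
by case: eqP; rewrite ?mulr1 ?mulr0.
Qed.

Lemma es_opp k (s : seq R) : es k (map -%R s) = (-1) ^+ k * es k s.
Proof.
elim: s k => [|x s IH] [|k]; rewrite /= ?es0 ?mul1r//.
  by rewrite es_oversize// mulr0.
by rewrite !esS !IH exprS; ring.
Qed.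

(** [eigenvals] comes in no particular order, so it is compared with [lam] through the coefficients
    of the characteristic polynomial, which are the elementary symmetric functions up to sign. The
    given [lam] excludes the default value. *)
Lemma eigenvals_es n (A : 'M[R]_n) (lam : 'rV[R]_n) :
  char_poly A = \prod_i ('X - (lam 0 i)%:P) ->
  forall k, elem_sym k (eigenvals A) = es k (row_seq lam).
Proof.
move=> chA k.
have chA' : char_poly A = \prod_i ('X - (eigenvals A 0 i)%:P).
  by rewrite /eigenvals; case: xgetP => [y -> //|/(_ lam)].
have row_es (d : 'rV[R]_n) : char_poly A = \prod_i ('X - (d 0 i)%:P) ->
    forall j, (j <= n)%N -> es j (row_seq d) = (-1) ^+ j * (char_poly A)`_(n - j).
  move=> -> j jn; have -> : \prod_i ('X - (d 0 i)%:P) =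
      \prod_(x <- map -%R (row_seq d)) ('X + x%:P).
    rewrite /row_seq big_map big_map big_enum /=.
    by apply: eq_bigr => i _; rewrite polyCN.
  have sz : size (map -%R (row_seq d)) = n by rewrite size_map size_map size_enum_ord.
  rewrite coef_prod_XaddC sz ?leq_subr// subKn// es_opp mulrA -exprD addnn.
  by rewrite -signr_odd odd_double mul1r.
rewrite elem_symE; have [kn|kn] := leqP k n; first by rewrite !row_es.
by rewrite !es_oversize// size_map size_enum_ord.
Qed.

(** Serves to evaluate the operator at radial functions, with [al = psi' (1 + mu |x|)] and
    [be = psi'']. *)
Lemma Smx_rank1 n k (al be : R) (x : 'rV[R]_n.+1) :
  Smx k.+1 (al%:M + be *: (x^T *m x)) =
  'C(n.+1, k.+1)%:R * al ^+ k.+1 + 'C(n, k)%:R * (be * sqnorm x) * al ^+ k.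
Proof. by rewrite /Smx (eigenvals_es (char_poly_rank1 _ _ _)) es_rank1_row. Qed.

(** The hypothesis orders two quadratic forms. An orthogonal change of basis [Q] that diagonalises
    [A] keeps the comparison matrix of the same shape, with [x] replaced by [x *m Q], and reduces
    the claim to [es_diag_le_rank1]. *)
Lemma Smx_le_rank1 n k (A : 'M[R]_n.+1) (al be : R) (x : 'rV[R]_n.+1) :
  (0 < k)%N -> 0 <= be -> A^T = A -> Gamma k (eigenvals A) ->
  (forall v : 'rV[R]_n.+1, \sum_i \sum_j v 0 i * v 0 j * A i j <=
     al * sqnorm v + be * (\sum_i v 0 i * x 0 i) ^+ 2) ->
  Smx k A <= Smx k (al%:M + be *: (x^T *m x)).
Proof.
move=> k0 be0 symA GA H.
(* If the characteristic polynomial did not split, [eigenvals A] would be the zero row, whose first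
   elementary symmetric function is not positive. *)
have chA : char_poly A = \prod_(y <- row_seq (eigenvals A)) ('X - y%:P).
  rewrite /row_seq big_map big_enum /=.
  have := GA 1%N; rewrite k0 => /(_ isT).
  rewrite /eigenvals; case: xgetP => [y _ -> //|_].
  rewrite /elem_sym big1 ?ltxx// => B /cards1P[i ->].
  by rewrite big_set1 mxE.
have [Q [d [QQ AQ]]] := symmetric_diag symA chA.
have chd : char_poly A = \prod_i ('X - (d 0 i)%:P).
  have QTQ : Q^T *m (Q^T)^T = 1%:M by rewrite trmxK (mulmx1C QQ).
  by rewrite -(char_poly_diag d) -(char_poly_conj (diag_mx d) QTQ) trmxK -AQ.
have -> : Smx k A = es k (row_seq d) by exact: eigenvals_es.
rewrite /Smx (eigenvals_es (char_poly_rank1 _ _ _)).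
rewrite -(orthogonal_sqnorm x QQ); apply: es_diag_le_rank1 => //; last first.
  case=> [_|p pk]; first by rewrite es0 ler01.
  by rewrite -(eigenvals_es chd) ltW// GA.
move=> y; have := H (y *m Q^T).
have -> : sqnorm (y *m Q^T) = sqnorm y.
  by apply: orthogonal_sqnorm; rewrite trmxK (mulmx1C QQ).
have -> : \sum_i (y *m Q^T) 0 i * x 0 i = \sum_i y 0 i * (x *m Q) 0 i.
  have E (u v : 'rV[R]_n.+1) : (u *m v^T) 0 0 = \sum_i u 0 i * v 0 i.
    by rewrite mulmx_trE mxE eqxx mulr1n.
  by rewrite -!E trmx_mul mulmxA.
suff -> : \sum_i \sum_j (y *m Q^T) 0 i * (y *m Q^T) 0 j * A i j =
    \sum_i y 0 i ^+ 2 * d 0 i by [].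
have quad (v : 'rV[R]_n.+1) (M : 'M[R]_n.+1) :
    \sum_i \sum_j v 0 i * v 0 j * M i j = (v *m M *m v^T) 0 0.
  rewrite mxE exchange_big /=; apply: eq_bigr => j _.
  rewrite !mxE mulr_suml; apply: eq_bigr => i _; ring.
have QTQ : Q^T *m Q = 1%:M by rewrite (mulmx1C QQ).
rewrite quad {1}AQ trmx_mul trmxK !mulmxA -(mulmxA y) QTQ mulmx1.
rewrite -(mulmxA (y *m _)) QTQ mulmx1 mxE; apply: eq_bigr => i _.
by rewrite mul_mx_diag !mxE; ring.
Qed.

End HessianOperator.

(** * Directional derivatives *)

Section DirectionalDerivatives.
Variables (R : realType) (V : normedModType R).
Implicit Types (f a b : V -> R) (x v w : V).

Lemma is_derive_line f x v l t :
  is_derive (t *: v + x) v f l <->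
  is_derive t 1 (fun s : R => f (s *: v + x)) l.
Proof.
have E : (fun h : R => h^-1 *: ((f \o shift (t *: v + x)) (h *: v) - f (t *: v + x))) =
   (fun h => h^-1 *: (((fun s => f (s *: v + x)) \o shift t) (h *: 1) - f (t *: v + x))).
  by apply/funext => h /=; rewrite scalerDl addrA [h *: 1]mulr1.
by split=> -[d1 d2]; split; rewrite /derivable /derive E in d1 d2 *.
Qed.

Lemma is_derive_line0 f x v l :
  is_derive x v f l <-> is_derive (0 : R) 1 (fun s : R => f (s *: v + x)) l.
Proof. by rewrite -is_derive_line scale0r add0r. Qed.

Lemma is_derive_comp1 (g : R -> R) f x v l m :
  is_derive x v f l -> is_derive (f x) 1 g m -> is_derive x v (g \o f) (m * l).
Proof.
move=> /is_derive_line0 df dg; apply/is_derive_line0.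
apply: (@is_derive1_comp _ g (fun s => f (s *: v + x))).
by rewrite scale0r add0r.
Qed.

End DirectionalDerivatives.

Lemma is_derive_epsP (R : realType) (V : normedModType R) (f : V -> R) x v l :
  (forall e : R, 0 < e -> exists2 d : R, 0 < d &
     forall h, h != 0 -> `|h| < d -> `|h^-1 * (f (h *: v + x) - f x) - l| < e) ->
  is_derive x v f l.
Proof.
move=> H.
have C : (fun h : R => h^-1 *: ((f \o shift x) (h *: v) - f x)) @ 0^' --> l.
  apply/cvgrPdist_lt => e /H[d d0 Hd].
  rewrite near_withinE; exists d => //= h /=; rewrite sub0r normrN => hd h0.
  by rewrite distrC; apply: Hd.
split; first by apply/cvg_ex; exists l.
exact: cvg_lim C.
Qed.

Lemma is_derive_eps (R : realType) (F : R -> R) (t l : R) : is_derive t 1 F l ->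
  forall e : R, 0 < e -> exists2 d : R, 0 < d &
     forall h, h != 0 -> `|h| < d -> `|h^-1 * (F (h + t) - F t) - l| < e.
Proof.
move=> [d1 d2] e e0; have /cvgrPdist_lt/(_ e e0) := (d1 : cvg _).
rewrite -[lim _]/('D_1 F t) d2 near_withinE => -[d /= d0 Hd]; exists d => // h h0 hd.
by have := Hd h; rewrite /= sub0r normrN distrC [h *: 1]mulr1 => /(_ hd h0).
Qed.

Section DirectionalCalculus.
Variables (R : realType) (V : normedModType R).
Implicit Types (f a b : V -> R) (x v w : V).

Lemma continuous_eps a x : {for x, continuous a} ->
  forall e : R, 0 < e -> exists2 d : R, 0 < d &
     forall y, `|y - x| < d -> `|a y - a x| < e.
Proof.
move=> ca e e0; have /cvgrPdist_lt/(_ e e0) := ca.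
move=> /nbhs_normP[d /= d0 Hd]; exists d => // y yd.
by rewrite distrC; apply: Hd; rewrite /= distrC.
Qed.

Lemma line_MVT f a x v (h : R) : (forall y, is_derive y v f (a y)) ->
  exists2 s : R, `|s| <= `|h| & f (h *: v + x) - f x = a (s *: v + x) * h.
Proof.
move=> df.
have dF (t : R) : is_derive t (1 : R) (fun s : R => f (s *: v + x)) (a (t *: v + x)).
  exact: (is_derive_line f x v (a (t *: v + x)) t).1 (df _).
have cF (i : interval R) : {within [set` i], continuous (fun s : R => f (s *: v + x))}.
  by apply: derivable_within_continuous => t _; case: (dF t).
have [h0|h0] := leP 0 h.
  have [s /[!in_itv]/= /andP[s0 sh]] := MVT_segment h0 (fun t _ => dF t) (cF _).
  by rewrite scale0r add0r subr0; exists s => //; rewrite !ger0_norm.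
have [s /[!in_itv]/= /andP[s0 sh]] := MVT_segment (ltW h0) (fun t _ => dF t) (cF _).
rewrite scale0r add0r sub0r => E; exists s.
  by rewrite !ler0_norm ?lerN2// ltW.
by rewrite -opprB E mulrN opprK.
Qed.

(** The increment along [v + w] is one along [v] from [x] plus one along [w] from a displaced point;
    the latter is handled by the mean value theorem and the continuity of [b]. This yields all
    directional derivatives from the partial ones, which is what [C2] provides. *)
Lemma is_derive_dirD f a b v w :
  (forall y, is_derive y v f (a y)) -> (forall y, is_derive y w f (b y)) ->
  continuous b -> forall y, is_derive y (v + w) f (a y + b y).
Proof.
move=> da db cb x; apply: is_derive_epsP => e e0.
have e2 : 0 < e / 2 by rewrite divr_gt0.
have [d1 d10 H1] := is_derive_eps ((is_derive_line0 _ _ _ _).1 (da x)) e2.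
have [d2 d20 H2] := continuous_eps (cb x) e2.
pose c := `|v| + `|w| + 1; have c0 : 0 < c by rewrite ltr_wpDl ?addr_ge0.
exists (Num.min d1 (d2 / c)); first by rewrite lt_min d10 divr_gt0.
move=> h h0; rewrite lt_min => /andP[hd1 hd2].
have [s sh E] := line_MVT (h *: v + x) h db.
have -> : h^-1 * (f (h *: (v + w) + x) - f x) - (a x + b x) =
   (h^-1 * (f (h *: v + x) - f x) - a x) + (b (s *: w + (h *: v + x)) - b x).
  have -> : h *: (v + w) + x = h *: w + (h *: v + x).
    by rewrite scalerDr addrA [_ + h *: v]addrC.
  have -> : f (h *: w + (h *: v + x)) =
      b (s *: w + (h *: v + x)) * h + f (h *: v + x) by rewrite -E subrK.
  by field.
rewrite (le_lt_trans (ler_normD _ _))// [ltRHS]splitr ltrD//.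
  by have := H1 h h0 hd1; rewrite addr0 scale0r add0r.
apply: H2; rewrite !addrA addrK (le_lt_trans (ler_normD _ _))// !normrZ.
rewrite (@le_lt_trans _ _ (`|h| * c))//; last by rewrite -ltr_pdivlMr.
rewrite /c !mulrDr mulr1 [X in _ <= X + _]addrC -addrA.
by rewrite lerD ?ler_wpM2r// ler_wpDr.
Qed.

Lemma is_derive_dirZ f a v (c : R) :
  (forall y, is_derive y v f (a y)) -> forall y, is_derive y (c *: v) f (c * a y).
Proof.
move=> da x; apply/is_derive_line0.
have -> : (fun s : R => f (s *: (c *: v) + x)) =
   (fun t : R => f (t *: v + x)) \o (fun s => s * c).
  by apply/funext => s /=; rewrite scalerA.
have dc : is_derive (0 : R) (1 : R) (fun s : R => s * c) c.
  apply: is_derive_epsP => e e0; exists 1 => // h h0 _.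
  by rewrite addr0 mul0r subr0 [h *: 1]mulr1 mulrA mulVf// mul1r subrr normr0.
rewrite mulrC; apply: (@is_derive1_comp _ (fun t : R => f (t *: v + x))).
by rewrite mul0r; exact: (is_derive_line0 f x v (a x)).1 (da x).
Qed.

(* Both mixed derivatives are limits of the second difference of [f]. *)
Lemma mixed_derivatives f a b c d v w :
  (forall y, is_derive y v f (a y)) -> (forall y, is_derive y w f (b y)) ->
  (forall y, is_derive y w a (c y)) -> (forall y, is_derive y v b (d y)) ->
  continuous c -> continuous d -> c =1 d.
Proof.
move=> da db dc dd cc cd x.
have diff2 (f1 a1 c1 : V -> R) (v1 w1 : V) (h : R) :
    (forall y, is_derive y v1 f1 (a1 y)) -> (forall y, is_derive y w1 a1 (c1 y)) ->
    exists s t : R, [/\ `|s| <= `|h|, `|t| <= `|h| &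
      f1 (h *: v1 + (h *: w1 + x)) - f1 (h *: w1 + x) - (f1 (h *: v1 + x) - f1 x) =
      c1 (t *: w1 + (s *: v1 + x)) * h * h].
  move=> da1 dc1.
  pose g y := f1 (h *: w1 + y) - f1 y.
  have dg y : is_derive y v1 g (a1 (h *: w1 + y) - a1 y).
    apply: is_deriveB; apply/is_derive_line0.
    under eq_fun => s do rewrite addrCA.
    exact: (is_derive_line0 f1 (h *: w1 + y) v1 _).1 (da1 _).
  have [s sh] := line_MVT x h dg; rewrite /g => E.
  have [t th E'] := line_MVT (s *: v1 + x) h dc1.
  exists s, t; split=> //; rewrite -E' -E.
  by rewrite [h *: v1 + (h *: w1 + x)]addrCA; ring.
apply/eqP; rewrite -subr_eq0 -normr_eq0 eq_le normr_ge0 andbT.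
apply/ler_addgt0Pl => e e0; rewrite addr0.
have e2 : 0 < e / 2 by rewrite divr_gt0.
have [d1 d10 H1] := continuous_eps (cc x) e2.
have [d2 d20 H2] := continuous_eps (cd x) e2.
pose k := `|v| + `|w| + 1; have k0 : 0 < k by rewrite ltr_wpDl ?addr_ge0.
pose h := Num.min d1 d2 / 2 / k.
have h0 : 0 < h by rewrite !divr_gt0// lt_min d10.
have hk : `|h| * k < Num.min d1 d2.
  rewrite gtr0_norm// /h divfK ?gt_eqF//.
  by rewrite ltr_pdivrMr// ltr_pMr ?lt_min ?d10// ltr1n.
have near_x (s t : R) (v1 w1 : V) : `|v1| + `|w1| + 1 = k -> `|s| <= `|h| ->
    `|t| <= `|h| -> `|t *: w1 + (s *: v1 + x) - x| < Num.min d1 d2.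
  move=> k1 sh th; rewrite !addrA addrK (le_lt_trans (ler_normD _ _))// !normrZ.
  rewrite (le_lt_trans _ hk)// -k1 !mulrDr mulr1 [X in _ <= X + _]addrC -addrA.
  by rewrite lerD ?ler_wpM2r// ler_wpDr// ler_wpM2r.
have [s [t [sh th E1]]] := diff2 _ _ _ _ _ h da dc.
have [s' [t' [sh' th' E2]]] := diff2 _ _ _ _ _ h db dd.
have Ecd : c (t *: w + (s *: v + x)) = d (t' *: v + (s' *: w + x)).
  apply: (@mulIf _ h); first by rewrite gt_eqF.
  apply: (@mulIf _ h); first by rewrite gt_eqF.
  by rewrite -E1 -E2 [h *: v + (h *: w + x)]addrCA; ring.
have := near_x s t v w erefl sh th; rewrite lt_min => /andP[/H1 X1 _].
have := near_x s' t' w v; rewrite [`|w| + _]addrC lt_min => /(_ erefl sh' th')/andP[_ /H2 X2].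
rewrite Ecd in X1; rewrite distrC in X1.
have := ler_normD (c x - d (t' *: v + (s' *: w + x))) (d (t' *: v + (s' *: w + x)) - d x).
rewrite addrA subrK => /le_trans; apply.
by rewrite ltW// [ltRHS]splitr ltrD.
Qed.

End DirectionalCalculus.

Section PointwiseContinuity.
Variables (R : realType) (T : topologicalType).
Implicit Types f g : T -> R.

Lemma cont_cst (c : R) : continuous (fun _ : T => c).
Proof. by move=> x; exact: cvg_cst. Qed.

Lemma contM f g : continuous f -> continuous g -> continuous (fun x => f x * g x).
Proof. by move=> cf cg x; apply: cvgM; [exact: cf|exact: cg]. Qed.

Lemma contD f g : continuous f -> continuous g -> continuous (fun x => f x + g x).
Proof. by move=> cf cg x; apply: cvgD; [exact: cf|exact: cg]. Qed.

Lemma contB f g : continuous f -> continuous g -> continuous (fun x => f x - g x).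
Proof. by move=> cf cg x; apply: cvgB; [exact: cf|exact: cg]. Qed.

Lemma contX f n : continuous f -> continuous (fun x => f x ^+ n).
Proof.
move=> cf; elim: n => [|n IH]; first exact: cont_cst.
under eq_fun => x do rewrite exprS.
exact: contM.
Qed.

Lemma cont_sum n (F : 'I_n -> T -> R) : (forall i, continuous (F i)) ->
  continuous (fun x => \sum_i F i x).
Proof. by move=> cF; apply: continuous_big => // ; exact: add_continuous. Qed.

Lemma cont_comp (h : R -> R) f : continuous f ->
  (forall x, {for f x, continuous h}) -> continuous (fun x => h (f x)).
Proof. by move=> cf ch x; apply: continuous_comp; [exact: cf|exact: ch]. Qed.

End PointwiseContinuity.

(** * Second-order calculus on row vectors *)

Section RowVectorCalculus.
Variable R : realType.

Lemma is_derive_partials n (f : 'rV[R]_n -> R) (g : 'I_n -> 'rV[R]_n -> R) :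
  (forall i y, is_derive y (delta_mx 0 i) f (g i y)) ->
  (forall i, continuous (g i)) ->
  forall v y, is_derive y v f (\sum_i v 0 i * g i y).
Proof.
move=> df cg v.
suff H (s : seq 'I_n) y : is_derive y (\sum_(i <- s) v 0 i *: delta_mx 0 i) f
    (\sum_(i <- s) v 0 i * g i y).
  by move=> y; rewrite {1}(row_sum_delta v); exact: H.
elim: s y => [|i s IH] y; first by rewrite !big_nil; exact: is_derive0.
rewrite !big_cons addrC [in X in is_derive _ _ _ X]addrC.
have Di z := is_derive_dirZ (v 0 i) (df i) z.
by apply: (is_derive_dirD IH Di); apply: contM; [exact: cont_cst|exact: cg].

Qed.

(** If [l] were positive, [F1], which vanishes at 0, would be positive just to the right of 0, and
    by the mean value theorem [F] would exceed [F 0] there. *)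
Lemma second_derivative_test (F F1 : R -> R) (l d : R) : 0 < d ->
  (forall t : R, `|t| < d -> is_derive t (1 : R) F (F1 t)) ->
  (forall t, `|t| < d -> F t <= F 0) -> is_derive (0 : R) (1 : R) F1 l ->
  F1 0 = 0 /\ l <= 0.
Proof.
move=> d0 dF maxF dF1.
have F10 : F1 0 = 0.
  have dd : - d <= d by rewrite ge0_cp// ltW.
  have in_d (t : R) : t \in `]- d, d[%R -> `|t| < d by rewrite in_itv /= ltr_norml.
  have z0 : (0 : R) \in `]- d, d[%R by rewrite in_itv /= oppr_lt0 d0.
  have [_ E] : is_derive (0 : R) (1 : R) F 0.
    apply: (derive1_at_max dd _ z0) => t /in_d ht; last exact: maxF.
    by case: (dF t ht).
  by have /dF[_ <-] : `|0 : R| < d; rewrite ?normr0// E.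
split=> //; rewrite leNgt; apply/negP => l0.
have [e e0 He] := is_derive_eps dF1 l0.
pose t := Num.min d e / 2.
have t0 : 0 < t by rewrite divr_gt0// lt_min d0.
have tde : t < Num.min d e by rewrite ltr_pdivrMr// ltr_pMr ?ltr1n// lt_min d0.
have := tde; rewrite lt_min => /andP[td te].
have F1pos s : 0 < s -> s <= t -> 0 < F1 s.
  move=> s0 st; have := He s; rewrite gt_eqF// gtr0_norm// => /(_ isT).
  rewrite (le_lt_trans st te) addr0 F10 subr0 => /(_ isT).
  rewrite ltr_norml => /andP[+ _]; rewrite ltrBrDl subrr => h.
  by rewrite -(pmulr_rgt0 _ (_ : 0 < s^-1)) ?invr_gt0.
have dF' (s : R) : s \in `]0, t[%R -> is_derive s (1 : R) F (F1 s).
  rewrite in_itv /= => /andP[s0 st]; apply: dF.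
  by rewrite gtr0_norm// (lt_trans st).
have cF : {within `[0, t], continuous F}.
  apply: derivable_within_continuous => s; rewrite in_itv /= => /andP[s0 st].
  by case: (dF s) => //; rewrite ger0_norm// (le_lt_trans st).
have [s /[!in_itv]/= /andP[s0 st] E] := MVT t0 dF' cF.
have := maxF t; rewrite gtr0_norm// => /(_ td); rewrite leNgt => /negP; apply.
by rewrite -subr_gt0 E mulr_gt0 ?subr0// F1pos// ltW.
Qed.

Lemma hessian_sym n (u : 'rV[R]_n -> R) x : C2 u -> (hessian u x)^T = hessian u x.
Proof.
move=> [_ d1 d2]; apply/matrixP => i j; rewrite !mxE.
have D k y : is_derive y (delta_mx 0 k) u (partial k u y).
  by apply: derivableP; case: (d1 k).
have DD k l y : is_derive y (delta_mx 0 l) (partial k u) (partial l (partial k u) y).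
  by apply: derivableP; case: (d2 k l).
apply: (mixed_derivatives (D j) (D i)) => //.
  by case: (d2 j i).
by case: (d2 i j).
Qed.

(** The radial variable. Its gradient at [x] is [x] itself, so functions of it are smooth across the
    origin without further conditions. *)
Definition half_sqnorm n (x : 'rV[R]_n) : R := sqnorm x / 2.

Lemma half_sqnormD n (h : R) (v x : 'rV[R]_n) :
  half_sqnorm (h *: v + x) =
  half_sqnorm x + h * (\sum_i v 0 i * x 0 i) + h ^+ 2 * half_sqnorm v.
Proof.
rewrite /half_sqnorm /sqnorm !mulr_sumr !mulr_suml mulr_sumr -!big_split /=.
by apply: eq_bigr => i _; rewrite !mxE; field.
Qed.

Lemma half_sqnorm_ge0 n (x : 'rV[R]_n) : 0 <= half_sqnorm x.
Proof. by rewrite divr_ge0// sqnorm_ge0. Qed.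

Lemma is_derive_half_sqnorm n (x v : 'rV[R]_n) :
  is_derive x v (@half_sqnorm n) (\sum_i v 0 i * x 0 i).
Proof.
apply: is_derive_epsP => e e0; set a := \sum_i _.
have q0 : 0 < half_sqnorm v + 1 by rewrite ltr_wpDl// half_sqnorm_ge0.
exists (e / (half_sqnorm v + 1)); first by rewrite divr_gt0.
move=> h h0 hd; rewrite half_sqnormD.
have -> : h^-1 * (half_sqnorm x + h * a + h ^+ 2 * half_sqnorm v - half_sqnorm x) - a =
  h * half_sqnorm v by field.
rewrite normrM (ger0_norm (half_sqnorm_ge0 v)).
rewrite ltr_pdivlMr// in hd; apply: le_lt_trans hd.
by rewrite ler_wpM2l// lerDl.
Qed.

Lemma continuous_half_sqnorm n : continuous (@half_sqnorm n).
Proof.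
apply: contM; last exact: cont_cst.
by apply: cont_sum => i; apply: contX; exact: coord_continuous.
Qed.

End RowVectorCalculus.

(** * Radial functions and touching from above *)

Section Radial.
Variable R : realType.

Lemma is_derive_lincomb n (V : normedModType R) (x v : V) (c : 'I_n -> R)
    (h : 'I_n -> V -> R) (dh : 'I_n -> R) :
  (forall i, is_derive x v (h i) (dh i)) ->
  is_derive x v (fun y => \sum_i c i * h i y) (\sum_i c i * dh i).
Proof.
move=> H; have -> : (fun y => \sum_i c i * h i y) = \sum_i (c i \*: h i).
  by apply/funext => y; rewrite fct_sumE.
apply: is_derive_sum => i; apply: is_deriveZ.
Qed.

(** The difference is restricted to every line through [x0], where the second derivative test
    applies. Differentiability of [psi] is asked for only near [half_sqnorm x0], since the profile
    used later has a bounded life span. *)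
Lemma radial_touching n (u : 'rV[R]_n -> R) (psi psi1 : R -> R) (psi2 eta d : R)
    (x0 : 'rV[R]_n) : C2 u -> 0 < eta ->
  (forall s : R, `|s - half_sqnorm x0| < eta -> is_derive s (1 : R) psi (psi1 s)) ->
  is_derive (half_sqnorm x0) (1 : R) psi1 psi2 -> 0 < d ->
  (forall y, `|y - x0| < d ->
     u y - psi (half_sqnorm y) <= u x0 - psi (half_sqnorm x0)) ->
  grad u x0 = psi1 (half_sqnorm x0) *: x0 /\
  forall v : 'rV[R]_n, \sum_i \sum_j v 0 i * v 0 j * hessian u x0 i j <=
     psi1 (half_sqnorm x0) * sqnorm v + psi2 * (\sum_i v 0 i * x0 0 i) ^+ 2.
Proof.
move=> [_ d1 d2] eta0 dpsi dpsi1 d0 maxu.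
have D k y : is_derive y (delta_mx 0 k) u (partial k u y).
  by apply: derivableP; case: (d1 k).
have DD k l y : is_derive y (delta_mx 0 l) (partial k u) (partial l (partial k u) y).
  by apply: derivableP; case: (d2 k l).
have cD k : continuous (partial k u) by case: (d1 k).
have cDD k l : continuous (partial l (partial k u)) by case: (d2 k l).
have Dv := is_derive_partials D cD.
have DDv k := is_derive_partials (DD k) (cDD k).
have key (v : 'rV[R]_n) :
    \sum_i v 0 i * partial i u x0 = psi1 (half_sqnorm x0) * \sum_i v 0 i * x0 0 i /\
    \sum_i v 0 i * (\sum_j v 0 j * partial j (partial i u) x0) <=
      psi1 (half_sqnorm x0) * sqnorm v + psi2 * (\sum_i v 0 i * x0 0 i) ^+ 2.
  have [e e0 He] := continuous_eps (@continuous_half_sqnorm R n x0) eta0.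
  have v0 : 0 < `|v| + 1 by rewrite ltr_wpDl.
  pose r := Num.min d e / (`|v| + 1).
  have r0 : 0 < r by rewrite divr_gt0// lt_min d0.
  have near_x0 (t : R) : `|t| < r -> `|t *: v + x0 - x0| < Num.min d e.
    rewrite addrK normrZ ltr_pdivlMr//; apply: le_lt_trans.
    by rewrite ler_wpM2l// lerDl.
  pose ip (y : 'rV[R]_n) := \sum_i v 0 i * y 0 i.
  pose F (t : R) := u (t *: v + x0) - psi (half_sqnorm (t *: v + x0)).
  pose F1 (t : R) := \sum_i v 0 i * partial i u (t *: v + x0) -
     psi1 (half_sqnorm (t *: v + x0)) * ip (t *: v + x0).
  have dF (t : R) : `|t| < r -> is_derive t (1 : R) F (F1 t).
    move=> /near_x0; rewrite lt_min => /andP[_ /He ht].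
    have A1 := (is_derive_line u x0 v _ t).1 (Dv v (t *: v + x0)).
    have A2 := is_derive_comp1 (is_derive_half_sqnorm _ v) (dpsi _ ht).
    have A3 := (is_derive_line _ x0 v _ t).1 A2.
    exact: is_deriveB A1 A3.
  have maxF (t : R) : `|t| < r -> F t <= F 0.
    move=> /near_x0; rewrite lt_min => /andP[ht _].
    by rewrite /F scale0r add0r; apply: maxu.
  have dip : is_derive x0 v ip (sqnorm v).
    apply: is_derive_epsP => ee ee0; exists 1 => // h h0 _.
    have -> : ip (h *: v + x0) = h * sqnorm v + ip x0.
      rewrite /ip /sqnorm mulr_sumr -big_split; apply: eq_bigr => i _.
      by rewrite !mxE /=; ring.
    by rewrite addrK mulrA mulVf// mul1r subrr normr0.
  have dF1 : is_derive (0 : R) (1 : R) F1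
     (\sum_i v 0 i * (\sum_j v 0 j * partial j (partial i u) x0) -
      (psi1 (half_sqnorm x0) * sqnorm v + psi2 * ip x0 ^+ 2)).
    have A1 : is_derive x0 v (fun y => \sum_i v 0 i * partial i u y)
        (\sum_i v 0 i * (\sum_j v 0 j * partial j (partial i u) x0)).
      by apply: is_derive_lincomb => i; exact: DDv.
    have A2 := is_derive_comp1 (is_derive_half_sqnorm x0 v) dpsi1.
    have A3 := is_deriveM A2 dip.
    have A4 := (is_derive_line0 _ x0 v _).1 (is_deriveB A1 A3).
    apply: is_derive_eq A4 _; congr (_ - (_ + _)).
    by rewrite /= -/(ip x0) [_ *: _]mulrC expr2 -mulrA.
  have [F10 l0] := second_derivative_test r0 dF maxF dF1.
  split; last by rewrite -subr_le0.
  by move/eqP: F10; rewrite /F1 scale0r add0r subr_eq0 => /eqP.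
split.
  apply/rowP => i; rewrite !mxE; have [+ _] := key (delta_mx 0 i).
  have sd (g : 'I_n -> R) : \sum_j (delta_mx 0 i : 'rV[R]_n) 0 j * g j = g i.
    rewrite (bigD1 i)//= mxE !eqxx mul1r big1 ?addr0// => j ji.
    by rewrite mxE (negbTE ji) mul0r.
  by rewrite !sd.
move=> v; have [_] := key v; apply: le_trans; rewrite le_eqVlt; apply/orP; left.
apply/eqP; apply: eq_bigr => i _; rewrite mulr_sumr; apply: eq_bigr => j _.
by rewrite mxE mulrA.
Qed.

Lemma partial_radial n (psi psi1 : R -> R) (i : 'I_n) (x : 'rV[R]_n) :
  is_derive (half_sqnorm x) (1 : R) psi (psi1 (half_sqnorm x)) ->
  is_derive x (delta_mx 0 i) (fun y => psi (half_sqnorm y))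
    (psi1 (half_sqnorm x) * x 0 i).
Proof.
move=> dpsi; have := is_derive_comp1 (is_derive_half_sqnorm x (delta_mx 0 i)) dpsi.
rewrite (bigD1 i)//= mxE !eqxx mul1r big1 ?addr0// => j ji.
by rewrite mxE (negbTE ji) mul0r.
Qed.

Lemma is_derive_coord n (i j : 'I_n) (x : 'rV[R]_n) :
  is_derive x (delta_mx 0 j) (fun y : 'rV[R]_n => y 0 i) (i == j)%:R.
Proof.
apply: is_derive_epsP => e e0; exists 1 => // h h0 _.
rewrite !mxE eqxx /= addrK mulrA mulVf// mul1r.
by rewrite subrr normr0.
Qed.

(** The hypotheses concern [s >= 0] only: these are the values of [half_sqnorm], and the ones that
    the time map is later shown to reach. *)
Lemma radial_C2 n (psi psi1 psi2 : R -> R) :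
  (forall s : R, 0 <= s -> is_derive s (1 : R) psi (psi1 s)) ->
  (forall s : R, 0 <= s -> is_derive s (1 : R) psi1 (psi2 s)) ->
  (forall s : R, 0 <= s -> {for s, continuous psi2}) ->
  let u := fun x : 'rV[R]_n => psi (half_sqnorm x) in
  [/\ C2 u, forall x, grad u x = psi1 (half_sqnorm x) *: x &
     forall x, hessian u x =
       (psi1 (half_sqnorm x))%:M + psi2 (half_sqnorm x) *: (x^T *m x)].
Proof.
move=> d1 d2 c2 u.
have isc (g : R -> R) (s l : R) : is_derive s (1 : R) g l -> {for s, continuous g}.
  by move=> [+ _] => /derivable1_diffP; exact: differentiable_continuous.
have q0 := @half_sqnorm_ge0 R n.
have cq := @continuous_half_sqnorm R n.
have pu i x : is_derive x (delta_mx 0 i) u (psi1 (half_sqnorm x) * x 0 i).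
  by apply: partial_radial; exact: d1.
have puE i : partial i u = fun x => psi1 (half_sqnorm x) * x 0 i.
  by apply/funext => x; rewrite /partial; case: (pu i x).
have ppu i j x : is_derive x (delta_mx 0 j) (partial i u)
   (psi2 (half_sqnorm x) * (x 0 i * x 0 j) + psi1 (half_sqnorm x) * (i == j)%:R).
  rewrite puE; have A := is_deriveM (partial_radial j (d2 _ (q0 x))) (is_derive_coord i j x).
  apply: is_derive_eq A _; rewrite /= addrC; congr (_ + _).
  by rewrite /GRing.scale /=; ring.
have ppuE i j : partial j (partial i u) = fun x =>
   psi2 (half_sqnorm x) * (x 0 i * x 0 j) + psi1 (half_sqnorm x) * (i == j)%:R.
  by apply/funext => x; rewrite {1}/partial; case: (ppu i j x).
have cc i : continuous (fun x : 'rV[R]_n => x 0 i) by exact: coord_continuous.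
have c1 : continuous (fun x : 'rV[R]_n => psi1 (half_sqnorm x)).
  by apply: cont_comp => // x; exact: isc (d2 _ (q0 x)).
split.
- split.
  + by apply: cont_comp => // x; exact: isc (d1 _ (q0 x)).
  + move=> i; split; first by move=> x; case: (pu i x).
    by rewrite puE; apply: contM.
  + move=> i j; split; first by move=> x; case: (ppu i j x).
    rewrite ppuE; apply: contD; apply: contM => //; last exact: cont_cst.
      by apply: cont_comp => // x; exact: c2.
    exact: contM.
- by move=> x; apply/rowP => i; rewrite !mxE puE.
- move=> x; apply/matrixP => i j; rewrite !mxE ppuE big_ord1 !mxE addrC.
  by rewrite mulr_natr.
Qed.

End Radial.

(** * Primitives, time maps and improper integrals *)

Section Primitives.
Variable R : realType.
Implicit Types (f g h F G H P Q T : R -> R).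

Notation mu := (@lebesgue_measure R).
Notation D1 F x l := (is_derive (x : R) (1 : R) F l).

Lemma increment_le F G (F1 G1 : R -> R) (a b : R) : a <= b ->
  (forall x, a <= x <= b -> D1 F x (F1 x)) ->
  (forall x, a <= x <= b -> D1 G x (G1 x)) ->
  (forall x, a <= x <= b -> F1 x <= G1 x) -> F b - F a <= G b - G a.
Proof.
move=> ab dF dG le.
have dH (x : R) : x \in `[a, b]%R -> D1 (fun y => G y - F y) x (G1 x - F1 x).
  by rewrite in_itv => /= xab; apply: is_deriveB; [exact: dG|exact: dF].
have dH' (x : R) : x \in `]a, b[%R -> D1 (fun y => G y - F y) x (G1 x - F1 x).
  by move=> xab; apply: dH; exact: (subset_itv_oo_cc xab).
have cH : {within `[a, b], continuous (fun y => G y - F y)}.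
  by apply: derivable_within_continuous => x /dH[].
have [c cab E] := MVT_segment ab dH' cH.
rewrite -subr_ge0; have -> : G b - G a - (F b - F a) = G b - F b - (G a - F a) by ring.
by rewrite E mulr_ge0 ?subr_ge0//; apply: le; move: cab; rewrite in_itv.
Qed.

Lemma increment_eq F G (F1 : R -> R) (a b : R) : a <= b ->
  (forall x, a <= x <= b -> D1 F x (F1 x)) ->
  (forall x, a <= x <= b -> D1 G x (F1 x)) -> F b - F a = G b - G a.
Proof.
move=> ab dF dG; apply/eqP; rewrite eq_le.
by rewrite (increment_le ab dF dG)// (increment_le ab dG dF).
Qed.

Lemma is_derive_linear (c x : R) : D1 (fun y => c * y) x c.
Proof.
apply: is_derive_epsP => e e0; exists 1 => // h h0 _.
have -> : h^-1 * (c * (h *: 1 + x) - c * x) - c = 0.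
  by rewrite [h *: 1]mulr1; field.
by rewrite normr0.
Qed.

Lemma increment_ge F (F1 : R -> R) (a b c : R) : a <= b ->
  (forall x, a <= x <= b -> D1 F x (F1 x)) ->
  (forall x, a <= x <= b -> c <= F1 x) -> c * (b - a) <= F b - F a.
Proof.
move=> ab dF le; have := increment_le ab (fun x _ => is_derive_linear c x) dF le.
by rewrite mulrBr.
Qed.

Lemma increment_le_linear F (F1 : R -> R) (a b c : R) : a <= b ->
  (forall x, a <= x <= b -> D1 F x (F1 x)) ->
  (forall x, a <= x <= b -> F1 x <= c) -> F b - F a <= c * (b - a).
Proof.
move=> ab dF le; have := increment_le ab dF (fun x _ => is_derive_linear c x) le.
by rewrite mulrBr.
Qed.

Lemma is_derive_continuous F (x l : R) : D1 F x l -> {for x, continuous F}.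
Proof. by move=> [+ _] => /derivable1_diffP; exact: differentiable_continuous. Qed.

Lemma continuous_integrable_itv h (a b : R) : continuous h ->
  mu.-integrable `[a, b] (EFin \o h).
Proof.
move=> ch; apply: continuous_compact_integrable; first exact: segment_compact.
by apply: continuous_subspaceT => x; exact: ch.
Qed.

Lemma is_derive_Rintegral h (a x : R) : continuous h -> a < x ->
  D1 (fun y => \int[mu]_(t in `[a, y]) h t)%R x (h x).
Proof.
move=> ch ax.
have x1 : x < x + 1 by rewrite ltrDl.
have [d1 d2] := continuous_FTC1_closed x1 (continuous_integrable_itv a (x + 1) ch) ax (ch x).
split; [exact: d1|by rewrite -derive1E; exact: d2].
Qed.

(** The lower limit [- |y| - 1] lies below both [y] and 0. Subtracting the integral up to 0 makes
    the result independent of that limit, so near [x] it can be replaced by the fixed limit [a]. *)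
Lemma primitive_exists h : continuous h -> exists H, forall x, D1 H x (h x).
Proof.
move=> ch; pose I (a y : R) : R := (\int[mu]_(t in `[a, y]) h t)%R.
have dI a y : a < y -> D1 (I a) y (h y) by exact: is_derive_Rintegral.
have Ieq a b y : a < 0 -> b < 0 -> a < y -> b < y -> I a y - I a 0 = I b y - I b 0.
  move=> a0 b0 ay by_; have [y0|y0] := leP 0 y.
    by apply: (increment_eq y0) => x /andP[x0 _]; apply: dI; apply: lt_le_trans x0.
  have := @increment_eq (I a) (I b) h y 0 (ltW y0).
  move=> E; apply: oppr_inj; rewrite !opprB; apply: E => x /andP[yx _]; apply: dI.
    exact: lt_le_trans yx.
  exact: lt_le_trans yx.
pose H (y : R) := I (- `|y| - 1) y - I (- `|y| - 1) 0.
exists H => x.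
have ltm (y : R) : - `|y| - 1 < y.
  by rewrite (@lt_le_trans _ _ (- `|y|)) ?ltrBlDr ?ltrDl// lerNl -normrN ler_norm.
have lt0m (y : R) : - `|y| - 1 < 0 by rewrite -opprD oppr_lt0 ltr_wpDl.
pose a := - `|x| - 2.
have a0 : a < 0 by rewrite /a -opprD oppr_lt0 ltr_wpDl.
have ax : a < x.
  by rewrite (lt_trans _ (ltm x))// /a ltrD2l ltrN2 ltr1n.
apply: (@near_eq_is_derive _ _ _ (fun y => I a y - I a 0)); last first.
  rewrite -[h x]subr0; apply: is_deriveB; exact: dI.
near=> y; rewrite /H; apply: Ieq => //.
by near: y; exact: lt_nbhsr.
Unshelve. all: by end_near. Qed.

Lemma Rintegral_primitive h H (a b : R) : a < b -> continuous h ->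
  (forall x, D1 H x (h x)) ->
  (\int[mu]_(x in `[a, b]) (h x)%:E = (H b - H a)%:E)%E.
Proof.
move=> ab ch dH.
rewrite (continuous_FTC2 (F := H) ab) ?EFinB//.
- by apply: continuous_subspaceT => x; exact: ch.
- split; first by move=> x _; case: (dH x).
    by apply: cvg_at_right_filter; exact: is_derive_continuous (dH a).
  by apply: cvg_at_left_filter; exact: is_derive_continuous (dH b).
- by move=> x _; rewrite derive1E; case: (dH x).
Qed.

(** A bounded [H] has a limit at infinity, which makes the integral finite; conversely the integral
    dominates every increment of [H] from [a] on. This trades the improper integral for a statement
    on a primitive. *)
Lemma integral_itvy_infty h H (a : R) : continuous h -> (forall x, 0 <= h x) ->
  (forall x, D1 H x (h x)) ->
  (\int[mu]_(x in `[a, +oo[) (h x)%:E = +oo)%E <->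
  (forall B, exists2 x, a <= x & B < H x).
Proof.
move=> ch h0 dH.
have ndH (x y : R) : x <= y -> H x <= H y.
  move=> xy; rewrite -subr_ge0 -(mul0r (y - x)).
  exact: (@increment_ge H h).
split=> [Hoo B|HB].
  apply: contrapT => noB.
  have ub x : H x <= B.
    rewrite leNgt; apply/negP => BHx; apply: noB; exists (Num.max x a).
      by rewrite le_max lexx orbT.
    by rewrite (lt_le_trans BHx)// ndH// le_max lexx.
  have cvgH : H x @[x --> +oo%R] --> sup (range H).
    apply: nondecreasing_cvgr; first by move=> x y; exact: ndH.
    by exists B => _ [x _ <-].
  have E : (\int[mu]_(x in `[a, +oo[) (h x)%:E = (sup (range H))%:E - (H a)%:E)%E.
    apply: ge0_continuous_FTC2y => //.
    - by apply: continuous_subspaceT => x; exact: ch.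
    - by apply: cvg_at_right_filter; exact: is_derive_continuous (dH a).
    - by move=> x _; rewrite derive1E; case: (dH x).
  by rewrite E in Hoo.
apply: eq_infty => r; have [x ax Hx] := HB (`|r| + H a).
have {}ax : a < x.
  rewrite lt_neqAle ax andbT; apply: contraTneq Hx => ->.
  by rewrite -leNgt lerDr.
apply: (@le_trans _ _ (\int[mu]_(x in `[a, x]) (h x)%:E)%E).
  rewrite (Rintegral_primitive ax ch dH) lee_fin.
  by rewrite lerBrDr ltW// (le_lt_trans _ Hx)// lerD2r ler_norm.
apply: ge0_subset_integral => //.
- apply/measurable_EFinP; apply: measurable_funTS.
  exact: continuous_measurable_fun.
- by move=> y _; rewrite lee_fin.
- by move=> y /=; rewrite !in_itv /= => /andP[->].
Qed.

End Primitives.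

(** * Time maps and auxiliary primitives *)

Section TimeMap.
Variable R : realType.
Implicit Types (f g h F G H P Q T : R -> R).

Notation D1 F x l := (is_derive (x : R) (1 : R) F l).

Lemma IVT_le T (a b s : R) : a <= b -> continuous T -> T a <= s <= T b ->
  exists2 t, a <= t <= b & T t = s.
Proof.
move=> ab cT /andP[Tas sTb].
have [|t tab E] := @IVT R T a b s ab (continuous_subspaceT cT).
  by rewrite ge_min Tas le_max sTb orbT.
by exists t => //; move: tab; rewrite in_itv.
Qed.

(** [psi] inverts [T] only on its range and takes the default value 0 elsewhere. The conclusions are
    therefore stated at the points [T x]; which times are reached has to be settled in each
    application. *)
Lemma time_map G (c0 : R) : continuous G -> (forall x, 0 < G x) ->
  exists T psi : R -> R,
    [/\ T c0 = 0, forall x, D1 T x (G x)^-1, forall x, psi (T x) = x &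
        forall x, D1 psi (T x) (G x)].
Proof.
move=> cG G0.
have cGV : continuous (fun x => (G x)^-1).
  by move=> x; apply: cvgV; [rewrite gt_eqF|exact: cG].
have [T1 dT1] := primitive_exists cGV.
pose T (x : R) : R := T1 x - T1 c0.
have dT x : D1 T x (G x)^-1.
  by rewrite -[_^-1]subr0; apply: is_deriveB.
have incT (x y : R) : x < y -> T x < T y.
  move=> xy; have cT : {within `[x, y], continuous T}.
    by apply: derivable_within_continuous => z _; case: (dT z).
  have [z _ E] := MVT xy (fun z _ => dT z) cT.
  by rewrite -subr_gt0 E mulr_gt0 ?invr_gt0 ?subr_gt0.
have injT (x y : R) : T x = T y -> x = y.
  by move=> E; case: (ltgtP x y) => // /incT; rewrite E ltxx.
pose psi (s : R) : R := xget 0 [set x | T x = s].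
have psiT x : psi (T x) = x.
  by rewrite /psi; case: xgetP => [y _ /injT //|/(_ x)[]].
exists T, psi; split=> //; first by rewrite /T subrr.
move=> x; rewrite -[G x]invrK.
have Gx : (G x)^-1 != 0 by rewrite invr_eq0 gt_eqF.
apply: (is_derive_inverse _ _ (dT x) Gx); first by near=> y.
by near=> y; exact: is_derive_continuous (dT y).
Unshelve. all: by end_near. Qed.

(* Where [p x < x], the map [T] increases by a fixed amount on [[x / 2, x]]; this
   happens for bounded [x] only when [T] is bounded, so eventually [x <= p x]. *)
Lemma unbounded_time G T Q (p : R -> R) (a c : R) : 0 < a -> 0 < c ->
  (forall x, a <= x -> D1 T x (G x)^-1) -> (forall x, a <= x -> 0 < G x) ->
  (forall x, a <= x -> D1 Q x (p x)^-1) -> (forall x, a <= x -> 0 < p x) ->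
  (forall x y, a <= x -> x <= y -> p x <= p y) ->
  (forall x, a <= x -> G x <= c * (p x + x)) ->
  (forall B, exists2 x, a <= x & B < Q x) -> (forall B, exists2 x, a <= x & B < T x).
Proof.
move=> a0 c0 dT G0 dQ p0 pmono Gle Qoo B; apply: contrapT => noB.
have TB x : a <= x -> T x <= B.
  by move=> ax; rewrite leNgt; apply/negP => BT; apply: noB; exists x.
pose E := [set T x | x in [set x | a <= x]].
have supE : has_sup E.
  split; first by exists (T a), a; rewrite //= lexx.
  by exists B => _ [x /= ax <-]; exact: TB.
(* The fixed amount: if [p x < x], then [1 / G] is at least [1 / (2 c x)] on [[x / 2, x]], an
   interval of length [x / 2]. From [x0] on, [T] has less than this left to gain. *)
have d0 : 0 < (4 * c)^-1 by rewrite invr_gt0 mulr_gt0.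
have [_ [x0 /= ax0 <-] Tx0] := sup_adherent d0 supE.
have Tsup x : a <= x -> T x <= sup E by move=> ax; apply: sup_upper_bound => //; exists x.
have ndT x y : a <= x -> x <= y -> T x <= T y.
  move=> ax xy; rewrite -subr_ge0 -(mul0r (y - x)).
  apply: (@increment_ge _ T (fun x => (G x)^-1)) => // z /andP[xz _].
    by apply: dT; exact: le_trans xz.
  by rewrite invr_ge0 ltW// G0// (le_trans ax).
have ndQ x y : a <= x -> x <= y -> Q x <= Q y.
  move=> ax xy; rewrite -subr_ge0 -(mul0r (y - x)).
  apply: (@increment_ge _ Q (fun x => (p x)^-1)) => // z /andP[xz _].
    by apply: dQ; exact: le_trans xz.
  by rewrite invr_ge0 ltW// p0// (le_trans ax).
pose b := 2 * x0.
have ab : a <= b by rewrite /b; lra.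
have pge x : b <= x -> x <= p x.
  move=> bx; rewrite leNgt; apply/negP => px.
  have x0x : x0 <= x / 2 by rewrite ler_pdivlMr// mulrC.
  have ax2 := le_trans ax0 x0x.
  have xx2 : x / 2 <= x by rewrite ler_pdivrMr// ler_pMr; lra.
  have : (2 * c * x)^-1 * (x - x / 2) <= T x - T (x / 2).
    apply: (@increment_ge _ T (fun x => (G x)^-1)) => // z /andP[xz zx].
      by apply: dT; exact: le_trans xz.
    have az := le_trans ax2 xz.
    rewrite lef_pV2 ?posrE; [|by rewrite !mulr_gt0//; lra|exact: G0].
    rewrite (le_trans (Gle _ az))// [2 * c]mulrC -mulrA ler_wpM2l ?(ltW c0)//.
    by have := pmono _ _ az zx; lra.
  have -> : (2 * c * x)^-1 * (x - x / 2) = (4 * c)^-1.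
    by field; rewrite !gt_eqF//; lra.
  have := Tsup x (le_trans ab bx); have := ndT _ _ ax0 x0x; lra.
(* Beyond [b] one has [G <= 2 c p], so [T] grows at least as fast as [Q / (2 c)], and a bound on [T]
   becomes one on [Q]. *)
have Qle x : b <= x -> Q x <= Q b + 2 * c * (B - T b).
  move=> bx; have : (2 * c)^-1 * Q x - (2 * c)^-1 * Q b <= T x - T b.
    apply: (increment_le bx (F := fun x => (2 * c)^-1 * Q x)
       (F1 := fun x => (2 * c)^-1 * (p x)^-1) (G1 := fun x => (G x)^-1)).
    - move=> z /andP[bz _]; have := is_deriveZ (2 * c)^-1 (dQ z (le_trans ab bz)); exact.
    - by move=> z /andP[bz _]; apply: dT; exact: le_trans bz.
    move=> z /andP[bz _]; have az := le_trans ab bz.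
    rewrite -invfM lef_pV2 ?posrE; [|by rewrite !mulr_gt0 ?p0|exact: G0].
    rewrite (le_trans (Gle _ az))// [2 * c]mulrC -mulrA ler_wpM2l ?(ltW c0)//.
    by have := pge _ bz; lra.
  rewrite -mulrBr mulrC ler_pdivrMr ?mulr_gt0//.
  have := TB x (le_trans ab bx) => TxB; move=> H.
  have : (T x - T b) * (2 * c) <= (B - T b) * (2 * c).
    by rewrite ler_wpM2r ?lerD2r// ?mulr_ge0// ltW.
  by rewrite [X in _ -> _ <= _ + X]mulrC; lra.
have [x ax] := Qoo (Q b + 2 * c * (B - T b)).
rewrite ltNge => /negP; apply; have [|bx] := leP b x; first exact: Qle.
apply: (le_trans (ndQ _ _ ax (ltW bx))); rewrite lerDl.
by rewrite mulr_ge0 ?subr_ge0 ?TB// mulr_ge0// ltW.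
Qed.

(** Cutting [h] off to the left of [c0] gives a primitive that is nonnegative on the whole line. The
    functions [G] built from it stay positive everywhere, as [time_map] requires, and the original
    [h] is kept from [c0] on. *)
Lemma cutoff_primitive h (c0 : R) : continuous h -> (forall x, 0 <= h x) ->
  exists P h1 : R -> R,
    [/\ continuous h1, forall x, D1 P x (h1 x), forall x, 0 <= h1 x <= h x,
        forall x, c0 <= x -> h1 x = h x & forall x, 0 <= P x] /\ P (c0 - 1) = 0.
Proof.
move=> ch h0.
(* [x - c0 + 1] clamped to [[0, 1]] *)
pose chi (x : R) : R := (`|x - c0 + 1| - `|x - c0| + 1) / 2.
have cchi : continuous chi.
  have cx (d : R) : continuous (fun x : R => `|x - d|).
    move=> x; apply: cvg_norm; apply: cvgB; [exact: cvg_id|exact: cvg_cst].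
  apply: contM; last exact: cont_cst.
  apply: contD; last exact: cont_cst.
  apply: contB => //; have := cx (c0 - 1).
  by under eq_fun => x do rewrite opprB addrCA addrC.
have chi01 x : 0 <= chi x <= 1.
  by rewrite /chi; case: (ler0P (x - c0 + 1)); case: (ler0P (x - c0)) => ? ?; lra.
have chi0 x : x <= c0 - 1 -> chi x = 0.
  by move=> xc; rewrite /chi !ler0_norm; lra.
have chi1 x : c0 <= x -> chi x = 1.
  by move=> xc; rewrite /chi !ger0_norm; lra.
pose h1 (x : R) := chi x * h x.
have ch1 : continuous h1 by exact: contM.
have [P1 dP1] := primitive_exists ch1.
pose P (x : R) : R := P1 x - P1 (c0 - 1).
have dP x : D1 P x (h1 x) by rewrite -[h1 x]subr0; apply: is_deriveB.
have h10 x : 0 <= h1 x by rewrite mulr_ge0//; case/andP: (chi01 x).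
have P0 : P (c0 - 1) = 0 by rewrite /P subrr.
exists P, h1; split=> //; split=> //.
- by move=> x; rewrite h10 ler_piMl//; case/andP: (chi01 x).
- by move=> x cx; rewrite /h1 chi1// mul1r.
move=> x; have [xc|xc] := leP (c0 - 1) x.
  have := @increment_ge _ P h1 _ _ 0 xc (fun z _ => dP z) (fun z _ => h10 z).
  by rewrite mul0r P0 subr0.
have := @increment_le_linear _ P h1 _ _ 0 (ltW xc) (fun z _ => dP z).
rewrite mul0r P0 sub0r oppr_le0; apply=> z /andP[_ zc].
by rewrite /h1 chi0// mul0r.
Qed.

Lemma powR_root_exp (x : R) m : 0 <= x -> (x `^ m.+1%:R^-1) ^+ m.+1 = x.
Proof.
move=> x0; rewrite -powR_mulrn ?powR_ge0// -powRrM mulVf ?pnatr_eq0//.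
by rewrite powRr1.
Qed.

(** The factor [m.+1] cancels the exponent of the root: the root [y] of [H] satisfies [y' y^m = l],
    the relation required of [G]. *)
Lemma is_derive_root H (x l : R) m : 0 < H x -> D1 H x (m.+1%:R * l) ->
  D1 (fun y => H y `^ m.+1%:R^-1) x (l / (H x `^ m.+1%:R^-1) ^+ m).
Proof.
move=> Hx dH; set r : R := m.+1%:R^-1.
have dr := @is_derive1_powR R r (H x) Hx.
have := @is_derive1_comp _ (fun y => y `^ r) H x _ _ dr dH.
move=> A; apply: is_derive_eq A _.
rewrite powRB; last by rewrite (gt_eqF Hx) implybT.
rewrite powRr1 ?ltW//.
have Hy := powR_root_exp m (ltW Hx); have := powR_gt0 r Hx; move: Hy.
rewrite -/r; move: (H x `^ r) => y <- y0; rewrite exprS /r; field.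
by rewrite expf_neq0 gt_eqF// nat1r pnatr_eq0.
Qed.

End TimeMap.

(** * Existence of a subsolution *)

Section Existence.
Variable R : realType.
Implicit Types (f : R -> R).

Notation D1 F x l := (is_derive (x : R) (1 : R) F l).

Lemma root_le (y S : R) m : 0 <= y -> 0 <= S -> y ^+ m.+1 <= S -> y <= S `^ m.+1%:R^-1.
Proof.
move=> y0 S0 yS; rewrite -(@ler_pXn2r _ m.+1)// ?nnegrE ?powR_ge0//.
by rewrite powR_root_exp.
Qed.

Lemma ler_exp1 (x : R) m : 1 <= x -> x <= x ^+ m.+1.
Proof. by move=> x1; rewrite exprS ler_peMr ?exprn_ege1// (le_trans ler01). Qed.

Lemma enorm_sqnorm n (v : 'rV[R]_n) : enorm v = Num.sqrt (sqnorm v).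
Proof. by []. Qed.

Lemma enormZ n (c : R) (v : 'rV[R]_n) : 0 <= c -> enorm (c *: v) = c * enorm v.
Proof.
by move=> c0; rewrite !enorm_sqnorm sqnormZ sqrtrM ?sqr_ge0// sqrtr_sqr ger0_norm.
Qed.

Lemma sqr_enorm n (v : 'rV[R]_n) : enorm v ^+ 2 = sqnorm v.
Proof. by rewrite enorm_sqnorm sqr_sqrtr// sqnorm_ge0. Qed.

Lemma enorm_ge0 n (v : 'rV[R]_n) : 0 <= enorm v.
Proof. exact: sqrtr_ge0. Qed.

(* The summand [N * L] of [G] absorbs the gradient term when [mu < 0]. The size of [K]
   keeps [psi] below 1 on [[0, 1 / (2 K)]], hence [f] below [G / 2], where the factor
   [|x|^2] of [psi''] is too small to help. *)
Lemma growth_function k (f PF Q : R -> R) (N a : R) : continuous f ->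
  (forall t, 0 < f t) -> (forall s t : R, s <= t -> f s <= f t) -> 0 <= N -> 0 < a ->
  (forall x, D1 PF x (f x ^+ k.+1)) ->
  (forall x, a <= x -> D1 Q x ((PF x - PF 0) `^ k.+2%:R^-1)^-1) ->
  (forall B, exists2 x, a <= x & B < Q x) ->
  exists (G G1 T psi : R -> R) (K : R),
  [/\ forall x, D1 G x (G1 x), continuous G1, forall x, 0 < G x,
      forall x, 0 <= G1 x &
      forall x, 0 <= x -> K * f x ^+ k.+1 + N * G x ^+ k.+1 <= G1 x * G x ^+ k.+1] /\
  [/\ forall x, D1 psi (T x) (G x), forall x, psi (T x) = x,
      forall s, 0 <= s -> exists2 x, 0 <= x & T x = s,
      0 < K & forall x, 0 <= x -> 2 * K * T x < 1 -> f x <= G x / 2].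
Proof.
move=> fcont fpos fmono N0 a0 dPF dQ Qoo.
have cf : continuous (fun x => f x ^+ k.+1) by exact: contX.
have fk0 x : 0 < f x ^+ k.+1 by rewrite exprn_gt0.
have [P [h1 [[ch1 dP h1le h1E P0] Pm1]]] := cutoff_primitive 0 cf (fun x => ltW (fk0 x)).
(* [L] has derivative 1 from 0 on, so that [N * L] adds exactly [N] to [G1] there. *)
have [L [h2 [[ch2 dL h2le h2E L0] Lm1]]] :=
  cutoff_primitive 0 (@cont_cst R R 1) (fun x => ler01).
rewrite sub0r in Pm1 Lm1.
(* As initial value of [g ^+ k.+2] this gives [g >= 2 f(1)], hence [f x <= G x / 2] for all
   [x <= 1]. *)
pose C := (2 * f 1) ^+ k.+2.
have CE : C = (2 * f 1) ^+ k.+2 by [].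
have C0 : 0 < C by rewrite exprn_gt0// mulr_gt0.
clearbody C.
(* A bound for [k.+2%:R * P] on [[0, 1]]: [P] vanishes at -1, and its derivative is at most
   [f 1 ^+ k.+1] up to 1. *)
pose c1 := k.+2%:R * (2 * f 1 ^+ k.+1).
have c1E : c1 = k.+2%:R * (2 * f 1 ^+ k.+1) by [].
have c10 : 0 < c1 by rewrite !mulr_gt0.
clearbody c1.
(* The summands 1, [C] and [c1] ensure [H <= K^2 <= K ^+ k.+2], hence [g <= K] on [[0, 1]]; the
   summand [2 * N] covers [N * L], as [L <= 2] there. Together [G <= 2 * K] on [[0, 1]]. *)
have [K KE] : exists K, K = 1 + 2 * N + C + c1 by exists (1 + 2 * N + C + c1).
have K1 : 1 <= K by rewrite KE; lra.
have K0 : 0 < K := lt_le_trans ltr01 K1.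
pose H (x : R) := C + k.+2%:R * (K * P x).
have H0 x : 0 < H x by rewrite ltr_wpDr// !mulr_ge0 ?P0// ltW.
have dH x : D1 H x (k.+2%:R * (K * h1 x)).
  have A1 := is_deriveZ (k.+2%:R : R) (is_deriveZ K (dP x)).
  have A2 := is_deriveD (is_derive_cst C (x : R) (1 : R)) A1.
  by apply: is_derive_eq A2 _; rewrite add0r.
pose g (x : R) := H x `^ k.+2%:R^-1.
have gE x : g x ^+ k.+2 = H x by rewrite powR_root_exp// ltW.
have g0 x : 0 < g x by exact: powR_gt0.
have dg x : D1 g x (K * h1 x / g x ^+ k.+1) := is_derive_root (H0 x) (dH x).
pose G (x : R) := g x + N * L x.
pose G1 (x : R) := K * h1 x / g x ^+ k.+1 + N * h2 x.
have dG x : D1 G x (G1 x) by exact: is_deriveD (dg x) (is_deriveZ N (dL x)).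
have gG x : g x <= G x by rewrite lerDl mulr_ge0.
have G0 x : 0 < G x := lt_le_trans (g0 x) (gG x).
have cg : continuous g by move=> x; exact: is_derive_continuous (dg x).
have cG : continuous G by move=> x; exact: is_derive_continuous (dG x).
have G10 x : 0 <= G1 x.
  rewrite addr_ge0// mulr_ge0//; last by case/andP: (h2le x).
    by rewrite mulr_ge0 ?(ltW K0)//; case/andP: (h1le x).
  by rewrite invr_ge0 exprn_ge0// ltW.
have cG1 : continuous G1.
  apply: contD; apply: contM => //; try exact: cont_cst.
    by apply: contM => //; exact: cont_cst.
  move=> x; apply: cvgV; first by rewrite expf_neq0// gt_eqF.
  exact: contX.
have [T [psi [T0 dT psiT dpsi]]] := time_map 0 cG G0.
have Llin (x : R) : 0 <= x -> L x <= x + 1.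
  move=> x0; have x1 : -1 <= x by rewrite (le_trans _ x0)// lerN10.
  have := increment_le_linear x1 (fun z _ => dL z).
  move=> /(_ 1); rewrite Lm1 subr0 mul1r opprK; apply=> z _.
  by case/andP: (h2le z).
(* For the bound [G <= c (p + x)] of [unbounded_time]: from [a] on, [H] is at most a multiple of
   [F], which gives [g <= M p], and [L] grows at most linearly. *)
have Too : forall B, exists2 x, a <= x & B < T x.
  pose F (x : R) := PF x - PF 0.
  have Finc (x y : R) : x <= y -> F x <= F y.
    move=> xy; rewrite -subr_ge0 /F opprB addrA subrK -(mul0r (y - x)).
    by apply: (@increment_ge _ PF (fun z => f z ^+ k.+1)) => // z _; exact: ltW.
  have Fa : 0 < F a.
    rewrite (lt_le_trans (_ : 0 < f 0 ^+ k.+1 * (a - 0)))//.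
      by rewrite subr0 mulr_gt0.
    apply: (@increment_ge _ PF (fun z => f z ^+ k.+1)) => //; first exact: ltW.
    by move=> z /andP[z0 _]; rewrite lerXn2r ?nnegrE ?(ltW (fpos _))// fmono.
  have F0 x : a <= x -> 0 < F x by move=> ax; apply: lt_le_trans (Finc _ _ ax).
  pose p (x : R) := F x `^ k.+2%:R^-1.
  have p0 x : a <= x -> 0 < p x by move=> ax; rewrite powR_gt0 ?F0.
  have PE (x : R) : 0 <= x -> P x = P 0 + F x.
    move=> x0; have E : P x - P 0 = PF x - PF 0.
      apply: (increment_eq (F1 := fun z => f z ^+ k.+1) x0) => // z /andP[z0 _].
      by rewrite -(h1E z z0).
    by rewrite /F -E addrC subrK.
  pose cc := (C + k.+2%:R * (K * P 0)) / F a.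
  have cc0 : 0 <= cc.
    by rewrite divr_ge0 ?(ltW Fa)// addr_ge0 ?(ltW C0)// !mulr_ge0 ?P0// ltW.
  pose M := 1 + (cc + k.+2%:R * K).
  have M1 : 1 <= M by rewrite lerDl addr_ge0// mulr_ge0// ltW.
  have M0 : 0 <= M := le_trans ler01 M1.
  have gp x : a <= x -> g x <= M * p x.
    move=> ax; have x0 : 0 <= x := le_trans (ltW a0) ax.
    rewrite -(@ler_pXn2r _ k.+2)// ?nnegrE ?(ltW (g0 _))//; last first.
      by rewrite mulr_ge0// ltW// p0.
    rewrite gE exprMn powR_root_exp; last by rewrite ltW// F0.
    apply: (@le_trans _ _ (M * F x)); last first.
      by rewrite ler_wpM2r ?ler_exp1// ltW// F0.
    rewrite /H PE// /M.
    have : C + k.+2%:R * (K * P 0) <= cc * F x.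
      rewrite -[leLHS](@divfK _ (F a)) ?gt_eqF// -/cc ler_wpM2l//.
      exact: Finc.
    by have := F0 x ax; nra.
  pose c := M + N * (1 + a^-1).
  have ai : 0 < a^-1 by rewrite invr_gt0.
  have c0 : 0 < c by rewrite ltr_wpDr ?mulr_ge0 ?addr_ge0 ?(ltW ai)// (lt_le_trans ltr01).
  apply: (@unbounded_time _ G T Q p a c a0 c0) => //.
    move=> x y ax xy; apply: ge0_ler_powR; rewrite ?nnegrE ?invr_ge0//.
    - by rewrite ltW// F0.
    - by rewrite ltW// F0// (le_trans ax).
    - exact: Finc.
  move=> x ax; have x0 : 0 <= x := le_trans (ltW a0) ax.
  have h3 : x + 1 <= (1 + a^-1) * x.
    by rewrite mulrDl mul1r lerD2l ler_pdivlMl// mulr1.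
  have := gp x ax; have := ler_wpM2l N0 (le_trans (Llin _ x0) h3).
  have : 0 <= M * x by rewrite mulr_ge0.
  have : 0 <= N * (1 + a^-1) * p x.
    by rewrite !mulr_ge0 ?addr_ge0 ?(ltW ai)// ltW// p0.
  by rewrite /G /c; lra.
have incT (x y : R) : x <= y -> T x <= T y.
  move=> xy; rewrite -subr_ge0 -(mul0r (y - x)).
  by apply: (@increment_ge _ T (fun z => (G z)^-1)) => // z _; rewrite invr_ge0 ltW.
have cT : continuous T by move=> x; exact: is_derive_continuous (dT x).
exists G, G1, T, psi, K; split; split=> //.
- move=> x x0; rewrite /G1 (h1E x x0) (h2E x x0) mulr1 mulrDl lerD2r.
  rewrite -mulrA -mulrA ler_wpM2l ?(ltW K0)// ler_peMr ?(ltW (fk0 _))//.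
  rewrite ler_pdivlMl ?exprn_gt0// mulr1 lerXn2r ?nnegrE ?(ltW (g0 _))//.
  exact: ltW.
- move=> s s0; have [x ax sx] := Too s.
  have x0 : 0 <= x := le_trans (ltW a0) ax.
  have [|t /andP[t0 _] E] := @IVT_le R T 0 x s x0 cT; first by rewrite T0 s0 ltW.
  by exists t.
- move=> x x0 Tx.
  have G2K (z : R) : 0 <= z <= 1 -> G z <= 2 * K.
    move=> /andP[z0 z1].
    have zm1 : -1 <= z by rewrite (le_trans _ z0)// lerN10.
    have Pz : P z <= 2 * f 1 ^+ k.+1.
      have := increment_le_linear zm1 (fun y _ => dP y).
      move=> /(_ (f 1 ^+ k.+1)); rewrite Pm1 subr0 opprK => /(_ _)/le_trans; apply.
        move=> y /andP[_ yz]; have /andP[_ /le_trans] := h1le y; apply.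
        by rewrite lerXn2r ?nnegrE ?(ltW (fpos _))// fmono// (le_trans yz).
      by rewrite mulrC ler_wpM2r ?(ltW (fk0 _))//; lra.
    have gK : g z <= K.
      rewrite -(@ler_pXn2r _ k.+2)// ?nnegrE ?(ltW (g0 _)) ?(ltW K0)// gE.
      apply: (@le_trans _ _ (K * K)); last first.
        by rewrite -expr2 ler_weXn2l.
      have KP : K * (k.+2%:R * P z) <= K * c1 by rewrite ler_wpM2l ?(ltW K0)// c1E ler_wpM2l.
      rewrite /H mulrCA.
      apply: (le_trans (lerD (lexx C) KP)).
      have : C <= K * C by rewrite ler_peMl// ltW.
      have : K * (C + c1) <= K * K by rewrite ler_wpM2l ?(ltW K0)// KE; lra.
      by rewrite mulrDr; lra.
    have : N * L z <= N * 2 by rewrite ler_wpM2l// (le_trans (Llin _ z0)); lra.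
    by rewrite /G; lra.
  (* Moving from 0 to 1 with speed at most [2 * K] takes time at least [1 / (2 * K)], so an earlier
     time means [x <= 1]. *)
  have T1 : (2 * K)^-1 <= T 1.
    have := @increment_ge _ T (fun z => (G z)^-1) 0 1 (2 * K)^-1 ler01 (fun z _ => dT z).
    rewrite T0 !subr0 mulr1; apply=> z /G2K GK.
    by rewrite lef_pV2 ?posrE ?mulr_gt0.
  have x1 : x <= 1.
    rewrite leNgt; apply/negP => /ltW/incT/(le_trans T1).
    rewrite leNgt => /negP; apply; rewrite -[ltRHS]mul1r ltr_pdivlMr ?mulr_gt0//.
    by rewrite mulrC.
  rewrite ler_pdivlMr// mulrC; apply: le_trans (gG x).
  apply: (@le_trans _ _ (2 * f 1)); first by rewrite ler_wpM2l// fmono.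
  apply: root_le; rewrite ?mulr_ge0 ?(ltW (fpos _)) ?(ltW (H0 _))//.
  by rewrite /H -CE lerDl !mulr_ge0// ltW.
Qed.

End Existence.

Section Subsolution.
Variable R : realType.
Notation D1 F x l := (is_derive (x : R) (1 : R) F l).

Lemma sqnorm_half n (x : 'rV[R]_n) : sqnorm x = 2 * half_sqnorm x.
Proof. by rewrite /half_sqnorm mulrC divfK// pnatr_eq0. Qed.

(** S_k of the radial function has two terms. Where [K |x|^2 >= 1], the one with [psi''] dominates
    the power of [f]; closer to the origin the one with the pure power of [psi'] does, by the last
    property of [growth_function]. *)
Lemma subsolution_exists n k (f PF Q : R -> R) (mu a : R) : (k <= n)%N ->
  (k = 0%N \/ 0 <= mu) -> continuous f ->
  (forall t, 0 < f t) -> (forall s t : R, s <= t -> f s <= f t) -> 0 < a ->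
  (forall x, D1 PF x (f x ^+ k.+1)) ->
  (forall x, a <= x -> D1 Q x ((PF x - PF 0) `^ k.+2%:R^-1)^-1) ->
  (forall B, exists2 x, a <= x & B < Q x) ->
  exists u : 'rV[R]_n.+1 -> R, subsolution k.+1 mu f u.
Proof.
move=> kn kmu fcont fpos fmono a0 dPF dQ Qoo.
(* The value of [N] comes from [1 + mu r >= 1 / 2 - mu^2 r^2 / 2], that is, from
   [(1 + mu r)^2 >= 0]: for the Laplacian the loss is [n.+1 mu^2 / 2] times [r^2 G], which [N * G]
   in the bound on [G1 * G] compensates. *)
have N0 : 0 <= n.+1%:R * mu ^+ 2 / 2 :> R by rewrite divr_ge0// mulr_ge0// sqr_ge0.
have [G [G1 [T [psi [K [[dG cG1 G0 G10 GK] [dpsi psiT surjT K0 Gf]]]]]]] :=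
  growth_function fcont fpos fmono N0 a0 dPF dQ Qoo.
pose psi1 (s : R) := G (psi s); pose psi2 (s : R) := G1 (psi s) * G (psi s).
have cG : continuous G by move=> x; exact: is_derive_continuous (dG x).
have d1 (s : R) : 0 <= s -> D1 psi s (psi1 s).
  by move=> /surjT[x _ <-]; rewrite /psi1 psiT.
have d2 (s : R) : 0 <= s -> D1 psi1 s (psi2 s).
  move=> /surjT[x _ <-]; rewrite /psi2 psiT.
  have A : D1 G (psi (T x)) (G1 x) by rewrite psiT.
  exact: (@is_derive1_comp _ G psi (T x) _ _ A (dpsi x)).
have c2 (s : R) : 0 <= s -> {for s, continuous psi2}.
  move=> s0; apply: (@continuous_comp _ _ _ psi (fun t => G1 t * G t)).
    exact: is_derive_continuous (d1 s s0).
  by apply: contM.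
have [uC2 gradu hessu] := @radial_C2 R n.+1 psi psi1 psi2 d1 d2 c2.
set u := (fun x => psi (half_sqnorm x)) in uC2 gradu hessu.
have augE (x : 'rV[R]_n.+1) : aug_hessian mu u x =
    (psi1 (half_sqnorm x) * (1 + mu * enorm x))%:M +
    psi2 (half_sqnorm x) *: (x^T *m x).
  rewrite /aug_hessian hessu gradu enormZ; last exact: ltW (G0 _).
  rewrite addrAC; congr (_ + _); apply/matrixP => i j; rewrite !mxE.
  by case: (i == j); rewrite ?mulr1n ?mulr0n; ring.
have SE p (x : 'rV[R]_n.+1) : Smx p.+1 (aug_hessian mu u x) =
    'C(n.+1, p.+1)%:R * (psi1 (half_sqnorm x) * (1 + mu * enorm x)) ^+ p.+1 +
    'C(n, p)%:R * (psi2 (half_sqnorm x) * sqnorm x) *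
       (psi1 (half_sqnorm x) * (1 + mu * enorm x)) ^+ p.
  by rewrite augE Smx_rank1.
have main (x : 'rV[R]_n.+1) : f (u x) ^+ k.+1 <= Smx k.+1 (aug_hessian mu u x).
  rewrite SE; have [t t0 Tt] := surjT _ (half_sqnorm_ge0 x).
  set r := enorm x; have r0 : 0 <= r := enorm_ge0 x.
  have r2 : r ^+ 2 = sqnorm x := sqr_enorm x.
  have rT : r ^+ 2 = 2 * T t by rewrite r2 sqnorm_half Tt.
  rewrite /u /psi1 /psi2 -Tt psiT -r2.
  have fk0 : 0 < f t ^+ k.+1 by rewrite exprn_gt0.
  have Gt := G0 t; have G1t := G10 t; have GKt := GK t t0.
  have small : K * r ^+ 2 < 1 -> f t <= G t / 2.
    by move=> h; apply: Gf => //; rewrite mulrAC -rT mulrC.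
  have CC : 1 <= 'C(n.+1, k.+1)%:R :> R by rewrite ler1n bin_gt0.
  have CC' : 1 <= 'C(n, k)%:R :> R by rewrite ler1n bin_gt0.
  case: kmu => [k0|mu0].
    move: GKt CC CC' fk0; rewrite k0 bin1 bin0 !expr1 expr0 mulr1 mul1r => GKt _ _ ft.
    have HG : n.+1%:R * G t * (1 / 2) + r ^+ 2 * (K * f t) <=
        n.+1%:R * (G t * (1 + mu * r)) + G1 t * G t * r ^+ 2.
      have h1 : r ^+ 2 * (K * f t + n.+1%:R * mu ^+ 2 / 2 * G t) <= r ^+ 2 * (G1 t * G t).
        by rewrite ler_wpM2l// sqr_ge0.
      have h2 : 0 <= n.+1%:R * G t * ((1 + mu * r) ^+ 2 / 2).
        apply: mulr_ge0; first by rewrite mulr_ge0 ?ler0n ?(ltW Gt).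
        by rewrite divr_ge0 ?sqr_ge0.
      by lra.
    apply: le_trans HG.
    have nG : G t <= n.+1%:R * G t by rewrite ler_peMl ?(ltW Gt)// ler1n.
    have [Kr|/small fG] := leP 1 (K * r ^+ 2).
      have : f t <= K * r ^+ 2 * f t by rewrite ler_peMl// ltW.
      by lra.
    have : 0 <= r ^+ 2 * (K * f t) by rewrite !mulr_ge0 ?sqr_ge0// ltW.
    by lra.
  have al : G t <= G t * (1 + mu * r) by rewrite ler_peMr ?(ltW Gt)// lerDl mulr_ge0.
  have al0 : 0 <= G t * (1 + mu * r) := le_trans (ltW Gt) al.
  have b0 : 0 <= G1 t * G t * r ^+ 2 by rewrite !mulr_ge0 ?sqr_ge0// ltW.
  have X1 : G t ^+ k.+1 <= 'C(n.+1, k.+1)%:R * (G t * (1 + mu * r)) ^+ k.+1.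
    apply: (@le_trans _ _ ((G t * (1 + mu * r)) ^+ k.+1)).
      by rewrite lerXn2r ?nnegrE ?(ltW Gt).
    by rewrite ler_peMl ?exprn_ge0.
  have X2 : K * r ^+ 2 * f t ^+ k.+1 <=
      'C(n, k)%:R * (G1 t * G t * r ^+ 2) * (G t * (1 + mu * r)) ^+ k.
    apply: (@le_trans _ _ (G1 t * G t * r ^+ 2 * G t ^+ k)).
      have -> : G1 t * G t * r ^+ 2 * G t ^+ k = r ^+ 2 * (G1 t * G t ^+ k.+1).
        by rewrite [G t ^+ k.+1]exprS; ring.
      have -> : K * r ^+ 2 * f t ^+ k.+1 = r ^+ 2 * (K * f t ^+ k.+1) by ring.
      rewrite ler_wpM2l ?sqr_ge0//; apply: le_trans GKt.
      by rewrite lerDl mulr_ge0// exprn_ge0// ltW.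
    apply: ler_pM => //; first by rewrite exprn_ge0// ltW.
      by rewrite ler_peMl.
    by rewrite lerXn2r ?nnegrE ?(ltW Gt).
  have [Kr|/small fG] := leP 1 (K * r ^+ 2).
    have : f t ^+ k.+1 <= K * r ^+ 2 * f t ^+ k.+1 by rewrite ler_peMl// ltW.
    have := exprn_ge0 k.+1 (ltW Gt); lra.
  have : 0 <= K * r ^+ 2 * f t ^+ k.+1 by rewrite !mulr_ge0 ?sqr_ge0// ltW.
  have : f t ^+ k.+1 <= G t ^+ k.+1.
    by rewrite lerXn2r ?nnegrE ?(ltW Gt) ?(ltW (fpos _))//; lra.
  by lra.
have Spos x : 0 < Smx k.+1 (aug_hessian mu u x).
  by apply: lt_le_trans (main x); rewrite exprn_gt0.
exists u; split; last by move=> x; apply: root_le; rewrite ?(ltW (fpos _)) ?(ltW (Spos _)).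
split=> // x [//|p] /andP[_ pk]; rewrite -/(Smx _ _).
(* For [k = 0] only the order 1 has to be checked, and this is [Spos]; otherwise [mu >= 0] makes the
   first term of each S_p positive and the second nonnegative. *)
case: kmu => [k0|mu0]; first by move: pk; rewrite k0 ltnS leqn0 => /eqP ->; rewrite -k0.
have al0 : 0 < psi1 (half_sqnorm x) * (1 + mu * enorm x).
  by rewrite mulr_gt0 ?G0// ltr_wpDr// mulr_ge0// enorm_ge0.
have be0 : 0 <= psi2 (half_sqnorm x) * sqnorm x.
  by rewrite mulr_ge0 ?sqnorm_ge0// mulr_ge0 ?G10// ltW// G0.
rewrite SE; apply: ltr_wpDr.
  apply: mulr_ge0; last by rewrite exprn_ge0// ltW.
  by rewrite mulr_ge0 ?ler0n.
by rewrite mulr_gt0 ?exprn_gt0// ltr0n bin_gt0 (leq_trans pk).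
Qed.

End Subsolution.

(** * Nonexistence of subsolutions *)

Section Nonexistence.
Variable R : realType.
Notation D1 F x l := (is_derive (x : R) (1 : R) F l).

(** A bounded [Q] makes [(x / 2) / p x <= Q x - Q (x / 2)] bounded, so [p] grows at least linearly.
    Since [p ^+ k.+2 = F] is at most [x] times [f x ^+ k.+1], the same follows for [f]. The form
    [x - c0 + 1] is the length of [[c0 - 1, x]], over which [f ^+ k.+1] is integrated later. *)
Lemma superlinear k (f PF Q : R -> R) (a B c0 : R) :
  (forall t, 0 < f t) -> (forall s t : R, s <= t -> f s <= f t) -> 0 < a -> c0 <= 0 ->
  (forall x, D1 PF x (f x ^+ k.+1)) ->
  (forall x, a <= x -> D1 Q x ((PF x - PF 0) `^ k.+2%:R^-1)^-1) ->
  (forall x, a <= x -> Q x <= B) ->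
  exists2 W : R, 0 < W & forall x, c0 <= x -> x - c0 + 1 <= W * f x.
Proof.
move=> fpos fmono a0 c00 dPF dQ QB.
have fk0 x : 0 < f x ^+ k.+1 by rewrite exprn_gt0.
pose F (x : R) := PF x - PF 0.
have Finc (x y : R) : x <= y -> F x <= F y.
  move=> xy; rewrite -subr_ge0 /F opprB addrA subrK -(mul0r (y - x)).
  by apply: (@increment_ge _ PF (fun z => f z ^+ k.+1)) => // z _; exact: ltW.
have F0 (x : R) : 0 < x -> 0 < F x.
  move=> x0; rewrite (lt_le_trans (_ : 0 < f 0 ^+ k.+1 * (x - 0)))//.
    by rewrite subr0 mulr_gt0.
  apply: (@increment_ge _ PF (fun z => f z ^+ k.+1)) => //; first exact: ltW.
  by move=> z /andP[z0 _]; rewrite lerXn2r ?nnegrE ?(ltW (fpos _))// fmono.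
have Fle (x : R) : 0 < x -> F x <= f x ^+ k.+1 * x.
  move=> x0; rewrite -[in leRHS](subr0 x).
  apply: (@increment_le_linear _ PF (fun z => f z ^+ k.+1)) => //; first exact: ltW.
  move=> z /andP[_ zx].
  by rewrite subr0 lerXn2r ?nnegrE ?(ltW (fpos _))// fmono.
pose p (x : R) := F x `^ k.+2%:R^-1.
have p0 (x : R) : 0 < x -> 0 < p x by move=> x0; rewrite powR_gt0 ?F0.
have pinc (x y : R) : 0 < x -> x <= y -> p x <= p y.
  move=> x0 xy; apply: ge0_ler_powR; rewrite ?nnegrE ?invr_ge0//.
  - by rewrite ltW// F0.
  - by rewrite ltW// F0// (lt_le_trans x0).
  - exact: Finc.
have [B1 B1E] : exists B1, B1 = B - Q a + 1 by exists (B - Q a + 1).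
have B10 : 0 < B1 by rewrite B1E; have := QB a (lexx a); lra.
have px (x : R) : 2 * a <= x -> x <= 2 * B1 * p x.
  move=> ax; have ax2 : a <= x / 2 by rewrite ler_pdivlMr// mulrC.
  have x0 : 0 < x by lra.
  have xx : x / 2 <= x by lra.
  have : (p x)^-1 * (x - x / 2) <= Q x - Q (x / 2).
    apply: (@increment_ge _ Q (fun z => (p z)^-1)) => // z /andP[xz zx].
      by apply: dQ; exact: le_trans xz.
    have z0 : 0 < z := lt_le_trans a0 (le_trans ax2 xz).
    by rewrite lef_pV2 ?posrE ?p0//; exact: pinc.
  have Qmono : Q a <= Q (x / 2).
    rewrite -subr_ge0 -(mul0r (x / 2 - a)).
    apply: (@increment_ge _ Q (fun z => (p z)^-1)) => // z /andP[az _]; first exact: dQ.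
    by rewrite invr_ge0 ltW// p0// (lt_le_trans a0).
  have Qx := QB x (le_trans ax2 xx).
  move=> H; have {}H : (p x)^-1 * (x - x / 2) <= B1 by rewrite B1E; lra.
  by move: H; rewrite mulrC ler_pdivrMr ?p0//; lra.
have M10 : 1 <= 1 + 2 * B1 by lra.
pose M := (1 + 2 * B1) ^+ k.+2.
have M1 : 1 <= M by exact: exprn_ege1.
have M0 : 0 < M := lt_le_trans ltr01 M1.
have ME : M = (1 + 2 * B1) ^+ k.+2 by [].
clearbody M.
have xf (x : R) : 2 * a <= x -> x <= M * f x.
  move=> ax; have x0 : 0 < x by lra.
  rewrite -(@ler_pXn2r _ k.+1)// ?nnegrE ?(ltW x0) ?mulr_ge0 ?(ltW M0) ?(ltW (fpos _))//.
  rewrite -(ler_pM2r x0) -exprSr.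
  apply: (@le_trans _ _ (M * F x)).
    have -> : M * F x = ((1 + 2 * B1) * p x) ^+ k.+2.
      by rewrite exprMn powR_root_exp ?ME// ltW// F0.
    rewrite lerXn2r ?nnegrE ?(ltW x0)//; first by rewrite mulr_ge0 ?(ltW (p0 _ x0))//; lra.
    by have := px x ax; have := p0 _ x0; lra.
  rewrite exprMn -mulrA; apply: ler_pM; first exact: ltW M0.
  - exact: ltW (F0 _ x0).
  - exact: ler_exp1.
  - exact: Fle.
(* [Y] bounds [x - c0 + 1] for [x] up to [2 * a + (1 - c0)], where [f x >= f c0] suffices; beyond
   that point [x - c0 + 1 <= 2 * x]. *)
pose Y := 2 * a + (1 - c0) - c0 + 1.
have Y0 : 0 < Y by rewrite /Y; lra.
exists (2 * M + Y / f c0); first by rewrite addr_gt0 ?mulr_gt0 ?invr_gt0.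
move=> x c0x; rewrite mulrDl.
have fc : Y <= Y / f c0 * f x.
  by rewrite mulrAC ler_pdivlMr// ler_wpM2l ?(ltW Y0)// fmono.
have Mf : 0 <= M * f x by rewrite mulr_ge0 ?ltW.
have [x1|x1] := leP (2 * a + (1 - c0)) x.
  have := xf x (_ : 2 * a <= x); move=> /(_ ltac:(lra)).
  by have := Y0; lra.
by rewrite /Y in fc *; lra.
Qed.

(** [g] solves [g' g^(k+1) = f^(k+1)] from [c0] on, and [superlinear] bounds its primitive by a
    multiple of [f^(k+2)], whence [g <= A f]. [S1] bounds the life span for speed [g]; speed
    [eps * g] multiplies it by [1 / eps], while [A] and [S1] do not depend on [eps]. *)
Lemma blowup_profile k (f PF Q : R -> R) (a B c0 : R) : continuous f ->
  (forall t, 0 < f t) -> (forall s t : R, s <= t -> f s <= f t) -> 0 < a -> c0 <= 0 ->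
  (forall x, D1 PF x (f x ^+ k.+1)) ->
  (forall x, a <= x -> D1 Q x ((PF x - PF 0) `^ k.+2%:R^-1)^-1) ->
  (forall x, a <= x -> Q x <= B) ->
  exists (g g1 : R -> R) (A S1 : R),
  [/\ forall x, 0 < g x, forall x, D1 g x (g1 x),
    forall x, c0 <= x -> g1 x * g x ^+ k.+1 = f x ^+ k.+1,
    1 <= A & forall x, c0 <= x -> g x <= A * f x] /\
  (0 < S1 /\ forall eps, 0 < eps -> exists T psi : R -> R,
   [/\ T c0 = 0, forall x, D1 T x (eps * g x)^-1, forall x, psi (T x) = x,
       forall x, D1 psi (T x) (eps * g x) & forall x, c0 <= x -> T x <= S1 / eps]).
Proof.
move=> fcont fpos fmono a0 c00 dPF dQ QB.
have [W W0 fW] := superlinear fpos fmono a0 c00 dPF dQ QB.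
have cf : continuous (fun x => f x ^+ k.+1) by exact: contX.
have fk0 x : 0 < f x ^+ k.+1 by rewrite exprn_gt0.
have [P [h1 [[ch1 dP h1le h1E P0] Pm1]]] := cutoff_primitive c0 cf (fun x => ltW (fk0 x)).
(* Small enough to be bounded by [f x ^+ k.+2] for every [x >= c0]. *)
pose C := f c0 ^+ k.+2.
have C0 : 0 < C by rewrite exprn_gt0.
pose H (x : R) := C + k.+2%:R * P x.
have H0 x : 0 < H x by rewrite ltr_wpDr// mulr_ge0.
have dH x : D1 H x (k.+2%:R * h1 x).
  have A1 := is_deriveZ (k.+2%:R : R) (dP x).
  have A2 := is_deriveD (is_derive_cst C (x : R) (1 : R)) A1.
  by apply: is_derive_eq A2 _; rewrite add0r.
pose g (x : R) := H x `^ k.+2%:R^-1.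
have gE x : g x ^+ k.+2 = H x by rewrite powR_root_exp// ltW.
have g0 x : 0 < g x by exact: powR_gt0.
have dg x : D1 g x (h1 x / g x ^+ k.+1) := is_derive_root (H0 x) (dH x).
have cg : continuous g by move=> x; exact: is_derive_continuous (dg x).
pose A := 1 + k.+2%:R * W.
have A1 : 1 <= A by rewrite lerDl mulr_ge0// ltW.
have A0 : 0 < A := lt_le_trans ltr01 A1.
have gA x : c0 <= x -> g x <= A * f x.
  move=> cx; rewrite -(@ler_pXn2r _ k.+2)// ?nnegrE ?(ltW (g0 _))//; last first.
    by rewrite mulr_ge0 ?ltW.
  rewrite gE exprMn; apply: (@le_trans _ _ (A * f x ^+ k.+2)); last first.
    by rewrite ler_wpM2r ?exprn_ge0 ?(ltW (fpos _))// ler_exp1.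
  have -> : A * f x ^+ k.+2 = f x ^+ k.+2 + k.+2%:R * (W * f x ^+ k.+2).
    by rewrite /A; ring.
  apply: lerD; first by rewrite lerXn2r ?nnegrE ?(ltW (fpos _))// fmono.
  rewrite ler_wpM2l// [f x ^+ k.+2]exprS mulrA.
  apply: (@le_trans _ _ ((x - c0 + 1) * f x ^+ k.+1)); last first.
    by rewrite ler_wpM2r ?(ltW (fk0 _))// fW.
  have cx1 : c0 - 1 <= x by lra.
  have := increment_le_linear cx1 (fun y _ => dP y).
  have -> : (x - c0 + 1) * f x ^+ k.+1 = f x ^+ k.+1 * (x - (c0 - 1)) by ring.
  move=> /(_ (f x ^+ k.+1)); rewrite Pm1 subr0; apply=> y /andP[_ yx].
  have /andP[_ /le_trans] := h1le y; apply.
  by rewrite lerXn2r ?nnegrE ?(ltW (fpos _))// fmono.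
have [T1 [psi1 [T10 dT1 _ _]]] := time_map c0 cg g0.
have T1inc (x y : R) : x <= y -> T1 x <= T1 y.
  move=> xy; rewrite -subr_ge0 -(mul0r (y - x)).
  by apply: (@increment_ge _ T1 (fun z => (g z)^-1)) => // z _; rewrite invr_ge0 ltW.
have c0a : c0 <= a := le_trans c00 (ltW a0).
pose F (x : R) := PF x - PF 0.
have FP (x : R) : a <= x -> 0 < F x <= H x.
  move=> ax; have x0 : 0 < x := lt_le_trans a0 ax; apply/andP; split.
    rewrite (lt_le_trans (_ : 0 < f 0 ^+ k.+1 * (x - 0)))//.
      by rewrite subr0 mulr_gt0.
    apply: (@increment_ge _ PF (fun z => f z ^+ k.+1)) => //; first exact: ltW.
    by move=> z /andP[z0 _]; rewrite lerXn2r ?nnegrE ?(ltW (fpos _))// fmono.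
  have E : P x - P 0 = F x.
    apply: (increment_eq (F1 := fun z => f z ^+ k.+1) (ltW x0)) => // z /andP[z0 _].
    by rewrite -(h1E z (le_trans c00 z0)).
  rewrite -E /H (@le_trans _ _ (P x))//; first by rewrite gerBl.
  rewrite (@le_trans _ _ (k.+2%:R * P x))//; first by rewrite ler_peMl// ler1n.
  by rewrite lerDr ltW.
(* Beyond [a] one has [F <= H], so [T1] gains at most what [Q] gains; the final 1 ensures
   positivity. *)
pose S1 := T1 a + (B - Q a) + 1.
have QaB := QB a (lexx a).
have T1S (x : R) : c0 <= x -> T1 x <= S1.
  move=> cx; have [ax|xa] := leP a x; last first.
    by have := T1inc _ _ (ltW xa); rewrite /S1; lra.
  have : T1 x - T1 a <= Q x - Q a.
    apply: (@increment_le _ T1 Q (fun z => (g z)^-1) (fun z => (F z `^ k.+2%:R^-1)^-1)) => //.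
      by move=> z /andP[az _]; exact: dQ.
    move=> z /andP[az _]; have /andP[Fz FH] := FP z az.
    rewrite lef_pV2 ?posrE ?powR_gt0// ge0_ler_powR ?nnegrE ?invr_ge0 ?(ltW Fz)//.
    exact: ltW.
  by have := QB x ax; rewrite /S1; lra.
have S10 : 0 < S1 by have := T1inc _ _ c0a; rewrite T10 /S1; lra.
exists g, (fun x => h1 x / g x ^+ k.+1), A, S1; split; split=> //.
  by move=> x cx; rewrite divfK ?h1E// gt_eqF// exprn_gt0.
move=> eps eps0; have ceg : continuous (fun x => eps * g x).
  by apply: contM => //; exact: cont_cst.
have eg0 x : 0 < eps * g x by rewrite mulr_gt0.
have [T [psi [T0 dT psiT dpsi]]] := time_map c0 ceg eg0.
exists T, psi; split=> // x cx; rewrite ler_pdivlMr//.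
apply: le_trans (T1S x cx).
have E : T x - T c0 = eps^-1 * T1 x - eps^-1 * T1 c0.
  apply: (@increment_eq _ T (fun z => eps^-1 * T1 z) (fun z => (eps * g z)^-1)) => // z _.
  by have X := is_deriveZ eps^-1 (dT1 z); apply: is_derive_eq X _; rewrite invfM.
move: E; rewrite T0 T10 mulr0 !subr0 => ->.
by rewrite mulrC mulrA divff ?mul1r// gt_eqF.
Qed.

End Nonexistence.

(** * Comparison of a subsolution with the blow-up profile *)

Section Comparison.
Variable R : realType.
Notation D1 F x l := (is_derive (x : R) (1 : R) F l).

Lemma compact_half_ball n (S : R) : compact [set x : 'rV[R]_n.+1 | half_sqnorm x <= S].
Proof.
apply: bounded_closed_compact; last first.
  apply: (@closed_comp _ _ (@half_sqnorm R n.+1) [set s | s <= S]).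
    by move=> x _; exact: continuous_half_sqnorm.
  exact: closed_le.
exists (1 + 2 * S); split; first exact: num_real.
move=> M SM x /= xS.
have S0 : 0 <= S := le_trans (half_sqnorm_ge0 x) xS.
have M0 : 0 <= M by lra.
rewrite /Num.norm /= mx_normrE; apply/bigmax_leP; split=> // -[i j] _ /=.
rewrite ord1.
have x2 : x 0 j ^+ 2 <= 2 * S.
  have : sqnorm x <= 2 * S by rewrite sqnorm_half; lra.
  by apply: le_trans; rewrite /sqnorm (bigD1 j)//= lerDl sumr_ge0// => l _; exact: sqr_ge0.
have := real_normK (num_real (x 0 j)); have := normr_ge0 (x 0 j); nra.
Qed.

Lemma increasing_time (g T : R -> R) (c : R) : 0 < c -> (forall x, 0 < g x) ->
  (forall x, D1 T x (c * g x)^-1) -> forall x y, x < y -> T x < T y.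
Proof.
move=> c0 g0 dT x y xy.
have cT : {within `[x, y], continuous T}.
  by apply: derivable_within_continuous => z _; case: (dT z).
have [z _ E] := MVT xy (fun z _ => dT z) cT.
by rewrite -subr_gt0 E mulr_gt0 ?subr_gt0// invr_gt0 mulr_gt0.
Qed.

(** No limit at the blow-up sphere is needed: [u] is bounded on the fixed ball [q <= S1 / eps],
    which contains every ball where the profile lives, so one may stop at the radius where the
    profile exceeds that bound. An interior maximum of the difference then contradicts the
    strictness of the supersolution. *)
Lemma no_subsolution n k (f PF Q : R -> R) (mu a B : R) (u : 'rV[R]_n.+1 -> R) :
  (k <= n)%N -> continuous f ->
  (forall t, 0 < f t) -> (forall s t : R, s <= t -> f s <= f t) -> 0 < a ->
  (forall x, D1 PF x (f x ^+ k.+1)) ->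
  (forall x, a <= x -> D1 Q x ((PF x - PF 0) `^ k.+2%:R^-1)^-1) ->
  (forall x, a <= x -> Q x <= B) -> ~ subsolution k.+1 mu f u.
Proof.
move=> kn fcont fpos fmono a0 dPF dQ QB [[uC2 uG] uf].
(* The profile starts at [c0] at the centre, so the difference is at least 1 there; the bound by 0
   is a requirement of [blowup_profile]. *)
pose c0 : R := Num.min (u 0 - 1) 0.
have c00 : c0 <= 0 by rewrite ge_min lexx orbT.
have c0u : c0 <= u 0 - 1 by rewrite ge_min lexx.
have [g [g1 [A [S1 [[g0 dg gg A1 gA] [S10 prof]]]]]] :=
  blowup_profile fcont fpos fmono a0 c00 dPF dQ QB.
pose Cb : R := 'C(n.+1, k.+1)%:R.
have Cb1 : 1 <= Cb by rewrite ler1n bin_gt0.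
have CbC : 'C(n, k)%:R <= Cb by rewrite ler_nat binS leq_addl.
have C0 : 0 <= 'C(n, k)%:R :> R by rewrite ler0n.
(* Bounds [eps (1 + |mu| r)^2] when [eps <= 1] and [eps r^2 <= 2 S1]. *)
pose M2 := 2 + 4 * mu ^+ 2 * S1.
have M22 : 2 <= M2.
  by rewrite lerDl mulr_ge0 ?(ltW S10)// mulr_ge0 ?sqr_ge0.
(* One summand for each term of S_k: the pure power of [al], estimated through [g <= A f], and the
   term with [psi''], estimated through [eps r^2 <= 2 S1]. Their sum is at most
   [Cb * Bq * th ^+ k.+1] times the power of [f], and [th] is chosen to make this factor less than
   1. *)
pose Bq := A ^+ k.+1 + 2 * S1.
have Bq0 : 0 < Bq by rewrite addr_gt0 ?exprn_gt0 ?mulr_gt0// (lt_le_trans ltr01).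
have CB0 : 0 < Cb * Bq by rewrite mulr_gt0// (lt_le_trans ltr01).
pose th := (1 + Cb * Bq)^-1.
have th0 : 0 < th by rewrite invr_gt0 addr_gt0.
have th1 : th <= 1 by rewrite invf_le1 ?addr_gt0// lerDl ltW.
have CBth : Cb * Bq * th < 1 by rewrite ltr_pdivrMr ?addr_gt0// mul1r ltrDr.
clearbody th.
(* With this choice [eps * (1 + `|mu| * |x|) <= th] wherever [half_sqnorm x <= S1 / eps]. *)
pose eps := th ^+ 2 / M2.
have M20 : 0 < M2 := lt_le_trans (ltr0n _ 2) M22.
have eps0 : 0 < eps by rewrite divr_gt0 ?exprn_gt0.
have epsM : eps * M2 = th ^+ 2 by rewrite divfK// gt_eqF.
have th2 : th ^+ 2 <= th by rewrite expr2 ger_pMr.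
have epsth : eps <= th.
  by rewrite ler_pdivrMr// (le_trans th2)// ler_peMr ?(ltW th0)//; lra.
have eps1 : eps <= 1 := le_trans epsth th1.
clearbody eps.
have [T [psi [T0 dT psiT dpsi TS]]] := prof eps eps0.
have incT := increasing_time eps0 g0 dT.
have cT : continuous T by move=> x; exact: is_derive_continuous (dT x).
have cu : continuous u by case: uC2.
pose q := @half_sqnorm R n.+1.
have cq : continuous q by exact: continuous_half_sqnorm.
have q0 x : 0 <= q x := half_sqnorm_ge0 x.
have q00 : q 0 = 0 by rewrite /q /half_sqnorm /sqnorm big1 ?mul0r// => i _; rewrite mxE expr0n.
have [y0 _ uy0] : exists2 c, c \in [set x | q x <= S1 / eps] &
    forall t, t \in [set x | q x <= S1 / eps] -> u t <= u c.
  apply: EVT_max_rV; [|exact: compact_half_ball|exact: continuous_subspaceT].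
  by exists 0; rewrite /= q00 divr_ge0 ?ltW.
(* The profile is followed up to the height [t1], above the maximum of [u] on the large ball; [S2]
   is the time at which it gets there. *)
pose t1 := Num.max (u y0) c0 + 1.
have c0t1 : c0 < t1 by rewrite ltr_pwDr// le_max lexx orbT.
have ut1 : u y0 < t1 by rewrite ltr_pwDr// le_max lexx.
pose S2 := T t1.
have S20 : 0 < S2 by rewrite -T0; exact: incT.
have S2S : S2 <= S1 / eps by apply: TS; exact: ltW.
have surjT (s : R) : 0 <= s <= S2 -> exists2 t, c0 <= t <= t1 & T t = s.
  by move=> hs; apply: IVT_le => //; [exact: ltW|rewrite T0].
pose w (x : 'rV[R]_n.+1) := u x - psi (q x).
have [x0 x0S wx0] : exists2 c, c \in [set x | q x <= S2] &
    forall t, t \in [set x | q x <= S2] -> w t <= w c.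
  apply: EVT_max_rV; [by exists 0; rewrite /= q00 ltW|exact: compact_half_ball|].
  apply: continuous_in_subspaceT => x; rewrite inE /= => xS.
  have [|t _ Tt] := surjT (q x); first by rewrite q0.
  apply: (@continuousB _ _ _ u (psi \o q)); first exact: cu.
  by apply: continuous_comp; [exact: cq|rewrite -Tt; exact: is_derive_continuous (dpsi t)].
have {}x0S : q x0 <= S2 by move: x0S; rewrite inE.
have w1 : 1 <= w x0.
  apply: (@le_trans _ _ (w 0)); last by apply: wx0; rewrite inE /= q00 ltW.
  by rewrite /w q00 -T0 psiT; lra.
have [|t /andP[c0t tt1] Tt] := surjT (q x0); first by rewrite q0.
have utx : t + 1 <= u x0 by move: w1; rewrite /w -Tt psiT; lra.
(* On the boundary sphere the profile equals [t1 > u], which is incompatible with a difference of at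
   least 1. *)
have qS : q x0 < S2.
  rewrite lt_neqAle x0S andbT; apply/eqP => E.
  have tE : t = t1 by rewrite -(psiT t) -(psiT t1) Tt E.
  have : u x0 <= u y0 by apply: uy0; rewrite inE /= (le_trans x0S).
  by have := ut1; rewrite -tE; lra.
have [d d0 Hd] : exists2 d : R, 0 < d & forall y, `|y - x0| < d -> w y <= w x0.
  have gap : 0 < S2 - q x0 by rewrite subr_gt0.
  have [d d0 Hd] := continuous_eps (cq x0) gap.
  exists d => // y /Hd; rewrite ltr_distl => /andP[_ h].
  by apply: wx0; rewrite inE /=; lra.
pose psi1 (s : R) := eps * g (psi s).
pose psi2 := eps * g1 t * (eps * g t).
have dpsi2 : D1 psi1 (q x0) psi2.
  have dgt : D1 (fun y => eps * g y) (psi (T t)) (eps * g1 t).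
    by rewrite psiT; have X := is_deriveZ eps (dg t); exact: X.
  by rewrite -Tt; exact: (@is_derive1_comp _ (fun y => eps * g y) psi (T t) _ _ dgt (dpsi t)).
(* A two-sided neighbourhood is required even at [q x0 = 0]; [T] is defined to the left of [t] as
   well, so its values between [t - 1] and [t + 1] provide one. *)
pose eta := Num.min (T t - T (t - 1)) (T (t + 1) - T t).
have eta0 : 0 < eta by rewrite lt_min !subr_gt0 !incT// ?ltrDl// ltrBlDr ltrDl.
have dpsi1 (s : R) : `|s - q x0| < eta -> D1 psi s (psi1 s).
  rewrite -Tt ltr_distl => /andP[h1 h2].
  have h3 : T (t - 1) <= s <= T (t + 1).
    have : eta <= T t - T (t - 1) by rewrite ge_min lexx.
    have : eta <= T (t + 1) - T t by rewrite ge_min lexx orbT.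
    lra.
  have t11 : t - 1 <= t + 1 by lra.
  have [z _ <-] := IVT_le t11 cT h3.
  by rewrite /psi1 psiT.
have [gradu hessu] := radial_touching uC2 eta0 dpsi1 dpsi2 d0 Hd.
have psi1E : psi1 (q x0) = eps * g t by rewrite /psi1 -Tt psiT.
rewrite -/q psi1E in gradu hessu.
set r := enorm x0; have r0 : 0 <= r := enorm_ge0 x0.
have r2 : r ^+ 2 = sqnorm x0 := sqr_enorm x0.
have rS : r ^+ 2 <= 2 * (S1 / eps).
  by rewrite r2 sqnorm_half ler_wpM2l// (le_trans x0S).
have eg0 : 0 < eps * g t by rewrite mulr_gt0.
have g1t0 : 0 <= g1 t.
  rewrite -(pmulr_lge0 _ (_ : 0 < g t ^+ k.+1)) ?exprn_gt0// gg//.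
  by rewrite exprn_ge0// ltW.
have psi20 : 0 <= psi2 by rewrite mulr_ge0 ?(ltW eg0)// mulr_ge0// ltW.
pose al := eps * g t * (1 + mu * r).
(* At a maximum of the difference the gradients agree, so the terms [mu |Du| I] coincide and only
   the Hessians are compared. *)
have Mle : Smx k.+1 (aug_hessian mu u x0) <= Smx k.+1 (al%:M + psi2 *: (x0^T *m x0)).
  apply: Smx_le_rank1 => //; first by rewrite linearD /= hessian_sym// tr_scalar_mx.
  move=> v; have := hessu v; rewrite -/(q x0).
  have -> : \sum_i \sum_j v 0 i * v 0 j * aug_hessian mu u x0 i j =
     \sum_i \sum_j v 0 i * v 0 j * hessian u x0 i j + mu * (eps * g t * r) * sqnorm v.
    rewrite /sqnorm mulr_sumr -big_split; apply: eq_bigr => i _ /=.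
    rewrite [in RHS](bigD1 i)//= [in LHS](bigD1 i)//= {1 2}/aug_hessian.
    rewrite gradu enormZ ?(ltW eg0)// -/r.
    rewrite !mxE eqxx mulr1n -[RHS]addrA [X in _ = _ + X]addrC addrA; congr (_ + _).
      by ring.
    by apply: eq_bigr => j ji; rewrite !mxE eq_sym (negbTE ji) mulr0n addr0.
  by move=> H; rewrite /al; lra.
have fle : f t ^+ k.+1 <= Smx k.+1 (aug_hessian mu u x0).
  have S0 : 0 < Smx k.+1 (aug_hessian mu u x0) by apply: (uG x0 k.+1); rewrite /= leqnn.
  rewrite -[leRHS](powR_root_exp k (ltW S0)) lerXn2r ?nnegrE ?powR_ge0 ?(ltW (fpos _))//.
  by apply: le_trans (uf x0); apply: fmono; lra.
suff : Smx k.+1 (al%:M + psi2 *: (x0^T *m x0)) < f t ^+ k.+1.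
  by rewrite ltNge (le_trans fle Mle).
rewrite Smx_rank1 -r2.
pose R1 := eps * (1 + `|mu| * r).
have mur : 0 <= `|mu| * r by rewrite mulr_ge0.
have R10 : 0 <= R1 by rewrite mulr_ge0 ?(ltW eps0)// addr_ge0.
have R1th : R1 <= th.
  rewrite -(@ler_pXn2r _ 2)// ?nnegrE ?(ltW th0)// -epsM.
  have e1 : (1 + `|mu| * r) ^+ 2 <= 2 + 2 * mu ^+ 2 * r ^+ 2.
    have : (`|mu| * r) ^+ 2 = mu ^+ 2 * r ^+ 2 by rewrite exprMn real_normK ?num_real.
    by have := sqr_ge0 (1 - `|mu| * r); lra.
  have e2 : eps * (2 * mu ^+ 2 * r ^+ 2) <= 4 * mu ^+ 2 * S1.
    have -> : 4 * mu ^+ 2 * S1 = eps * (2 * mu ^+ 2 * (2 * (S1 / eps))).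
      by field; rewrite gt_eqF.
    by rewrite ler_wpM2l ?(ltW eps0)// ler_wpM2l// mulr_ge0 ?sqr_ge0.
  have e3 : eps * (1 + `|mu| * r) ^+ 2 <= M2.
    apply: (le_trans (ler_wpM2l (ltW eps0) e1)); rewrite mulrDr /M2 lerD//; lra.
  have -> : R1 ^+ 2 = eps * (eps * (1 + `|mu| * r) ^+ 2) by rewrite /R1; ring.
  by rewrite ler_wpM2l// ltW.
(* [al] is negative if [mu r < -1], so its powers are estimated through the absolute value. *)
have alR j : al ^+ j <= (g t * th) ^+ j.
  rewrite (le_trans (ler_norm _))// normrX lerXn2r ?nnegrE ?mulr_ge0 ?(ltW (g0 _)) ?(ltW th0)//.
  have -> : al = g t * (eps * (1 + mu * r)) by rewrite /al; ring.
  rewrite normrM gtr0_norm// ler_wpM2l ?(ltW (g0 _))//; apply: le_trans R1th.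
  rewrite normrM gtr0_norm// ler_wpM2l ?(ltW eps0)//.
  by rewrite (le_trans (ler_normD _ _))// normr1 lerD2l normrM (ger0_norm r0).
have thk0 : 0 <= th ^+ k.+1 by rewrite exprn_ge0// ltW.
have fk0 : 0 < f t ^+ k.+1 by rewrite exprn_gt0.
have X1 : Cb * al ^+ k.+1 <= Cb * (A ^+ k.+1 * th ^+ k.+1 * f t ^+ k.+1).
  rewrite ler_wpM2l ?(le_trans ler01)//; apply: (le_trans (alR _)).
  have -> : A ^+ k.+1 * th ^+ k.+1 * f t ^+ k.+1 = (A * f t * th) ^+ k.+1.
    by rewrite !exprMn; ring.
  rewrite lerXn2r ?nnegrE ?mulr_ge0 ?(ltW (g0 _)) ?(ltW th0) ?(ltW (fpos _)) ?(le_trans ler01)//.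
  by rewrite ler_wpM2r ?(ltW th0)// gA.
have X2 : 'C(n, k)%:R * (psi2 * r ^+ 2) * al ^+ k <=
    Cb * (2 * S1 * th ^+ k.+1 * f t ^+ k.+1).
  rewrite -mulrA; apply: (@le_trans _ _ (Cb * (psi2 * r ^+ 2 * (g t * th) ^+ k))).
    have P0 : 0 <= psi2 * r ^+ 2 by rewrite mulr_ge0 ?sqr_ge0.
    apply: (@le_trans _ _ ('C(n, k)%:R * (psi2 * r ^+ 2 * (g t * th) ^+ k))).
      by rewrite ler_wpM2l// ler_wpM2l.
    by rewrite ler_wpM2r// mulr_ge0// exprn_ge0// mulr_ge0 ?(ltW (g0 _)) ?(ltW th0).
  rewrite ler_wpM2l ?(le_trans ler01)//.
  (* The equation for [g] turns [g1 t * g t ^+ k.+1] into the power of [f]; a factor [eps^2 r^2]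
     remains, of which [eps r^2] is bounded by [2 S1] and the other [eps] by [th]. *)
  have -> : psi2 * r ^+ 2 * (g t * th) ^+ k =
      f t ^+ k.+1 * (th ^+ k * (eps * (eps * r ^+ 2))).
    by rewrite -(gg t c0t) /psi2 exprMn [g t ^+ k.+1]exprS; ring.
  have -> : 2 * S1 * th ^+ k.+1 * f t ^+ k.+1 = f t ^+ k.+1 * (th ^+ k * (th * (2 * S1))).
    by rewrite [th ^+ k.+1]exprS; ring.
  rewrite ler_wpM2l ?(ltW fk0)// ler_wpM2l ?exprn_ge0 ?(ltW th0)//.
  apply: ler_pM => //; rewrite ?mulr_ge0 ?sqr_ge0 ?(ltW eps0)//.
  have -> : 2 * S1 = eps * (2 * (S1 / eps)) by field; rewrite gt_eqF.
  by rewrite ler_wpM2l// ltW.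
apply: (le_lt_trans (lerD X1 X2)).
have -> : Cb * (A ^+ k.+1 * th ^+ k.+1 * f t ^+ k.+1) + Cb * (2 * S1 * th ^+ k.+1 * f t ^+ k.+1) =
   Cb * Bq * th ^+ k.+1 * f t ^+ k.+1 by rewrite /Bq; ring.
rewrite -[ltRHS]mul1r ltr_pM2r//; apply: le_lt_trans CBth.
rewrite ler_wpM2l ?(ltW CB0)// exprS ger_pMr// exprn_ile1//.
exact: ltW.
Qed.

End Comparison.

Theorem theorem1p2 (R : realType) (n k : nat) (mu : R) (f : R -> R) (a : R)
    (hn : (1 <= n)%N) (hk : (1 <= k <= n)%N)
    (fcont : continuous f)
    (fpos : forall t : R, 0 < f t)
    (fmono : forall s t : R, s <= t -> f s <= f t)
    (hmu : (k = 1%N /\ mu < mu0 R n k) \/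
           ((2 <= k <= n)%N /\ 0 <= mu < mu0 R n k))
    (ha : 0 < a) :
  (exists u : 'rV[R]_n -> R, subsolution k mu f u) <->
  (\int[lebesgue_measure]_(tau in `[a, +oo[)
     ((\int[lebesgue_measure]_(t in `[0%R, tau]) (f t ^+ k))%R
        `^ (- (k.+1%:R^-1)))%:E = +oo)%E.
Proof.
case: k hk hmu => // k /andP[_ kn] hmu; case: n hn kn hmu => // n _ kn hmu.
have {}kn : (k <= n)%N := kn.
have {}hmu : k = 0%N \/ 0 <= mu.
  by case: hmu => [[[->] _]|[_ /andP[mu0 _]]]; [left|right].
have cf : continuous (fun x => f x ^+ k.+1) by exact: contX.
have fk0 x : 0 < f x ^+ k.+1 by rewrite exprn_gt0.
(* [PF x - PF 0] is the inner integral, and [Q] below is a primitive of the outer integrand on [[a,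
   +oo[]; divergence thus means that [Q] is unbounded there. *)
have [PF dPF] := primitive_exists cf.
(* [m x] is the maximum of [x] and [a]; it makes [h] continuous on the whole line. *)
pose m (x : R) : R := (x + a + `|x - a|) / 2.
have cm : continuous m.
  apply: contM; last exact: cont_cst.
  apply: contD; first by apply: contD; [move=> x; exact: cvg_id|exact: cont_cst].
  by move=> x; apply: cvg_norm; apply: cvgB; [exact: cvg_id|exact: cvg_cst].
have mE x : a <= x -> m x = x by move=> ax; rewrite /m ger0_norm ?subr_ge0//; lra.
have ma x : a <= m x by rewrite /m; case: (ler0P (x - a)) => ?; lra.
have F0 x : a <= x -> 0 < PF x - PF 0.
  move=> ax; have x0 : 0 < x := lt_le_trans ha ax.
  rewrite (lt_le_trans (_ : 0 < f 0 ^+ k.+1 * (x - 0)))//.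
    by rewrite subr0 mulr_gt0.
  apply: (@increment_ge _ PF (fun z => f z ^+ k.+1)) => //; first exact: ltW.
  by move=> z /andP[z0 _]; rewrite lerXn2r ?nnegrE ?(ltW (fpos _))// fmono.
pose h (x : R) : R := (PF (m x) - PF 0) `^ (- k.+2%:R^-1).
have cPF : continuous PF by move=> x; exact: is_derive_continuous (dPF x).
have ch : continuous h.
  apply: (@cont_comp _ _ (fun y => y `^ (- k.+2%:R^-1))).
    apply: contB; last exact: cont_cst.
    by apply: (cont_comp cm) => x; exact: cPF.
  by move=> x; apply: is_derive_continuous (is_derive1_powR _ (F0 _ (ma x))).
have [Q dQ] := primitive_exists ch.
have dQ' x : a <= x -> is_derive (x : R) (1 : R) Q ((PF x - PF 0) `^ k.+2%:R^-1)^-1.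
  by move=> ax; apply: is_derive_eq (dQ x) _; rewrite /h mE// powRN.
have -> : (\int[lebesgue_measure]_(tau in `[a, +oo[)
     ((\int[lebesgue_measure]_(t in `[0%R, tau]) (f t ^+ k.+1))%R
        `^ (- (k.+2%:R^-1)))%:E = \int[lebesgue_measure]_(tau in `[a, +oo[) (h tau)%:E)%E.
  apply: eq_integral => x; rewrite inE /= in_itv /= andbT => ax.
  congr (_%:E); rewrite /h mE//; congr (_ `^ _).
  have x0 : 0 < x := lt_le_trans ha ax.
  by rewrite /Rintegral (Rintegral_primitive x0 cf dPF).
have h0 x : 0 <= h x by exact: powR_ge0.
rewrite (integral_itvy_infty a ch h0 dQ); split=> [[u usub] B|Qoo].
  apply: contrapT => noB.
  have QB x : a <= x -> Q x <= B.
    by move=> ax; rewrite leNgt; apply/negP => BQ; apply: noB; exists x.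
  exact: (no_subsolution kn fcont fpos fmono ha dPF dQ' QB usub).
exact: (subsolution_exists kn hmu fcont fpos fmono ha dPF dQ' Qoo).
Qed.
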